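(* Let $\{\mu_t\}_{t\ge0}$ be a weakly continuous $\rhd$-convolution semigroup with $\mu_0=\delta_0$, with associated pair $(\gamma,\tau)$. The following are equivalent: (1) there exists $t_0>0$ such that $\operatorname{supp}\mu_{t_0}\subset[0,\infty)$; (2) $\operatorname{supp}\mu_t\subset[0,\infty)$ for all $0\le t<\infty$; (3) $\operatorname{supp}\tau\subset[0,\infty)$, $\tau(\{0\})=0$, $\int_0^\infty\frac1x\,d\tau(x)<\infty$ and $\gamma\ge\int_0^\infty\frac1x\,d\tau(x)$.
   Context: For a probability measure $\mu$ on $\mathbb{R}$, $G_\mu(z)=\int\frac{1}{z-x}d\mu(x)$ on $\mathbb{C}^+$ and $H_\mu=1/G_\mu$; the monotone convolution $\mu\rhd\nu$ is the unique probability measure with $H_{\mu\rhd\nu}=H_\mu\circ H_\nu$. A weakly continuous $\rhd$-convolution semigroup is a family $\{\mu_t\}_{t\ge0}$ of probability measures, weakly continuous in $t$, with $\mu_s\rhd\mu_t=\mu_{s+t}$. It is known that for such a semigroup with $\mu_0=\delta_0$ there is a unique pair $(\gamma,\tau)$, $\gamma\in\mathbb{R}$, $\tau$ a positive finite measure, such that with the vector field $A(z)=-\gamma+\int_{\mathbb{R}}\frac{1+xz}{x-z}\,d\tau(x)$, the maps $H_t:=H_{\mu_t}$ solve $\frac{d}{dt}H_t(z)=A(H_t(z))$, $H_0(z)=z$, for $z\in\mathbb{C}\setminus\mathbb{R}$; $(\gamma,\tau)$ is called the associated pair. *)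

(* Defs.v *)
From HB Require Import structures.
From mathcomp Require Import all_boot all_order all_algebra.
From mathcomp Require Import all_classical all_reals all_analysis.
From mathcomp Require Import complex.

Set Implicit Arguments.
Unset Strict Implicit.
Unset Printing Implicit Defensive.

Import Order.TTheory GRing.Theory Num.Theory.
Import numFieldNormedType.Exports.

Local Open Scope classical_set_scope.
Local Open Scope ring_scope.

Section MonotoneDefs.
Variable R : realType.
Local Notation C := R[i].

Definition cint (mu : {measure set R -> \bar R}) (f : R -> C) : C :=
  Complex (Rintegral mu setT (fun x => complex.Re (f x)))
          (Rintegral mu setT (fun x => complex.Im (f x))).

Definition cauchy_transform (mu : probability R R) (z : C) : C :=
  cint mu (fun x => (z - (x%:C)%C)^-1).

Definition rcauchy (mu : probability R R) (z : C) : C :=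
  (cauchy_transform mu z)^-1.

Definition is_monotone_convolution (mu nu rho : probability R R) : Prop :=
  forall z : C, 0 < complex.Im z -> rcauchy rho z = rcauchy mu (rcauchy nu z).

Definition monotone_semigroup (mu : R -> probability R R) : Prop :=
  forall s t : R, 0 <= s -> 0 <= t -> is_monotone_convolution (mu s) (mu t) (mu (s + t)).

Definition weakly_continuous (mu : R -> probability R R) : Prop :=
  forall f : R -> R, continuous f -> (exists M : R, forall x, `|f x| <= M) ->
    {within [set t : R | 0 <= t], continuous (fun t => Rintegral (mu t) setT f)}.

Definition msupport (mu : set R -> \bar R) : set R :=
  [set x | forall e : R, 0 < e -> (0 < mu (ball x e))%E].

Definition vector_field (gamma : R) (tau : {finite_measure set R -> \bar R}) (w : C) : C :=
  - (gamma%:C)%C + cint tau (fun x => (1 + (x%:C)%C * w) / ((x%:C)%C - w)).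

Definition associated_pair (mu : R -> probability R R) (gamma : R)
    (tau : {finite_measure set R -> \bar R}) : Prop :=
  forall z : C, complex.Im z != 0 ->
    rcauchy (mu 0) z = z /\
    forall t : R, 0 < t ->
      is_derive t (1 : R) (fun s => complex.Re (rcauchy (mu s) z))
                (complex.Re (vector_field gamma tau (rcauchy (mu t) z))) /\
      is_derive t (1 : R) (fun s => complex.Im (rcauchy (mu s) z))
                (complex.Im (vector_field gamma tau (rcauchy (mu t) z))).

End MonotoneDefs.

(* Main.v *)
Require Import Defs.
From HB Require Import structures.
From mathcomp Require Import all_boot all_order all_algebra.
From mathcomp Require Import all_classical all_reals all_analysis.
From mathcomp Require Import measurable_realfun complex.
From mathcomp Require Import ring lra.

Import Order.TTheory GRing.Theory Num.Theory.
Import numFieldNormedType.Exports.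

Local Open Scope classical_set_scope.
Local Open Scope ring_scope.

Set Implicit Arguments.
Unset Strict Implicit.
Unset Printing Implicit Defensive.

(* (3) => (2): under (3) the vector field satisfies Im (A(w) / w) >= 0, so arg H_t(z) is nondecreasing
   in t; and arg H >= arg on the upper half-plane means that the Poisson integral of x dmu_t(x) is
   nonnegative, so mu_t has no mass on the negative axis.

   (1) => (3): since [mu_T] has no mass on the negative axis, Im H_T(z) = O(Im z) near each compact
   part of it, hence also Im H_s(z) = O(Im z) for s <= T, as Im H_s increases with s.  The two-point
   Schwarz-Pick inequality then makes Re H_s uniformly Lipschitz there, and a mass of [tau] on the
   negative axis would make the total growth of Im H_s over a fine grid too large.  So [tau] lives on
   [0, oo) and A is real and increasing on the negative axis.  If A were positive somewhere, hence
   near 0-, trajectories starting just above the axis close to 0 would reach Re > -delta before time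
   T and stay there, whereas Re H_T(x) < 0 stays away from 0 as Im z tends to 0.  So A <= 0 on the
   negative axis, and A(0-) = -gamma + int 1/x dtau by monotone convergence. *)

(** * Bounded measurable functions and the Cauchy-type kernels of the proof *)

Definition bounded_measurable {R : realType} (f : R -> R) : Prop :=
  measurable_fun setT f /\ exists M : R, forall x, `|f x| <= M.

Section BoundedMeasurable.
Context {R : realType}.
Implicit Types f g : R -> R.

Lemma bounded_measurable_cst (a : R) : bounded_measurable (fun _ : R => a).
Proof. by split; [exact: measurable_cst | exists `|a|]. Qed.

Lemma bounded_measurableD f g : bounded_measurable f -> bounded_measurable g ->
  bounded_measurable (fun x => f x + g x).
Proof.
move=> [mf [M fM]] [mg [K gK]]; split; first exact: measurable_funD.
by exists (M + K) => x; rewrite (le_trans (ler_normD _ _))// lerD.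
Qed.

Lemma bounded_measurableM f g : bounded_measurable f -> bounded_measurable g ->
  bounded_measurable (fun x => f x * g x).
Proof.
move=> [mf [M fM]] [mg [K gK]]; split; first exact: measurable_funM.
by exists (M * K) => x; rewrite normrM ler_pM.
Qed.

Lemma bounded_measurableZ (a : R) f : bounded_measurable f ->
  bounded_measurable (fun x => a * f x).
Proof. by move=> ?; apply: bounded_measurableM => //; exact: bounded_measurable_cst. Qed.

Lemma bounded_measurable_indic (A : set R) : measurable A ->
  bounded_measurable (\1_A : R -> R).
Proof.
move=> mA; split; first exact: measurable_indic.
by exists 1 => x; rewrite indicE; case: (_ \in _); rewrite ?normr1 ?normr0.
Qed.

Lemma bounded_measurable_sum (n : nat) (F : nat -> R -> R) :
  (forall j, bounded_measurable (F j)) ->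
  bounded_measurable (fun x => \sum_(j < n) F j x).
Proof.
move=> bF; elim: n => [|n IH].
  under eq_fun do rewrite big_ord0; exact: bounded_measurable_cst.
by under eq_fun do rewrite big_ord_recr /=; exact: bounded_measurableD.
Qed.

Lemma sqr_distD_gt0 (u v x : R) : v != 0 -> 0 < (x - u) ^+ 2 + v ^+ 2.
Proof. by move=> v0; rewrite ltr_wpDl ?sqr_ge0// exprn_even_gt0. Qed.

Lemma continuous_cauchy0 (u v : R) : v != 0 ->
  continuous (fun x : R => ((x - u) ^+ 2 + v ^+ 2)^-1).
Proof.
move=> v0 x; apply: cvgV; first by rewrite gt_eqF// sqr_distD_gt0.
apply: cvgD; last exact: cvg_cst.
apply: (@cvg_comp _ _ _ (fun x => x - u) (fun x => x ^+ 2)); last exact: exprn_continuous.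
by apply: cvgB; [exact: cvg_id | exact: cvg_cst].
Qed.

Lemma continuous_cauchy1 (u v : R) : v != 0 ->
  continuous (fun x : R => (x - u) / ((x - u) ^+ 2 + v ^+ 2)).
Proof.
move=> v0 x; apply: cvgM; last exact: continuous_cauchy0.
by apply: cvgB; [exact: cvg_id | exact: cvg_cst].
Qed.

Lemma cauchy0_bound (u v x : R) : v != 0 ->
  `|((x - u) ^+ 2 + v ^+ 2)^-1| <= (v ^+ 2)^-1.
Proof.
move=> v0; have := sqr_distD_gt0 u x v0 => N0.
rewrite gtr0_norm ?invr_gt0// lef_pV2 ?posrE ?exprn_even_gt0//.
by rewrite lerDr sqr_ge0.
Qed.

Lemma cauchy1_bound (u v x : R) : v != 0 ->
  `|(x - u) / ((x - u) ^+ 2 + v ^+ 2)| <= `|v|^-1.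
Proof.
move=> v0; have N0 := sqr_distD_gt0 u x v0.
rewrite normrM (gtr0_norm (_ : 0 < _^-1)) ?invr_gt0//.
rewrite ler_pdivrMr// mulrC ler_pdivlMr ?normr_gt0//.
rewrite -[in leRHS]real_normK ?num_real// -[v ^+ 2]real_normK ?num_real//.
by have := sqr_ge0 (`|x - u| - `|v|); have := normr_ge0 (x - u); have := normr_ge0 v; nra.
Qed.

Lemma bounded_measurable_cauchy0 (u v : R) : v != 0 ->
  bounded_measurable (fun x : R => ((x - u) ^+ 2 + v ^+ 2)^-1).
Proof.
move=> v0; split; last by exists (v ^+ 2)^-1 => x; exact: cauchy0_bound.
by apply: continuous_measurable_fun; exact: continuous_cauchy0.
Qed.

Lemma bounded_measurable_cauchy1 (u v : R) : v != 0 ->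
  bounded_measurable (fun x : R => (x - u) / ((x - u) ^+ 2 + v ^+ 2)).
Proof.
move=> v0; split; last by exists `|v|^-1 => x; exact: cauchy1_bound.
by apply: continuous_measurable_fun; exact: continuous_cauchy1.
Qed.

(** Polynomial division leaves a constant and multiples of the two Cauchy kernels. The real and
    imaginary kernels of the vector field, whose numerators are quadratic in [x], all fall under
    this case. *)
Lemma bounded_measurable_quadratic (a b c u v : R) : v != 0 ->
  bounded_measurable (fun x : R => (a + b * x + c * x ^+ 2) / ((x - u) ^+ 2 + v ^+ 2)).
Proof.
move=> v0.
have -> : (fun x : R => (a + b * x + c * x ^+ 2) / ((x - u) ^+ 2 + v ^+ 2)) =
  (fun x => c + ((b + 2 * c * u) * ((x - u) / ((x - u) ^+ 2 + v ^+ 2)) +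
     (a + b * u + c * u ^+ 2 - c * v ^+ 2) * ((x - u) ^+ 2 + v ^+ 2)^-1)).
  by apply/funext => x; have := gt_eqF (sqr_distD_gt0 u x v0) => N0; field; rewrite N0.
apply: bounded_measurableD; first exact: bounded_measurable_cst.
apply: bounded_measurableD; apply: bounded_measurableZ.
  exact: bounded_measurable_cauchy1.
exact: bounded_measurable_cauchy0.
Qed.

End BoundedMeasurable.

(** * Integration of bounded functions against a finite measure, up to null sets *)

Section RealIntegral.
Context {R : realType} (m : {finite_measure set R -> \bar R}).
Implicit Types f g : R -> R.

Local Notation int f := (Rintegral m setT f).

Lemma bounded_measurable_integrable f :
  bounded_measurable f -> m.-integrable setT (EFin \o f).
Proof.
move=> [mf [M fM]]; apply: measurable_bounded_integrable => //.
  by rewrite -ge0_fin_numE//; exact: fin_num_measure.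
exists M; split; first exact: num_real.
by move=> y My x _ /=; exact: le_trans (fM x) (ltW My).
Qed.

Lemma RintD f g : bounded_measurable f -> bounded_measurable g ->
  int (fun x => f x + g x) = int f + int g.
Proof. by move=> ? ?; apply: RintegralD => //; exact: bounded_measurable_integrable. Qed.

Lemma RintZ (a : R) f : bounded_measurable f -> int (fun x => a * f x) = a * int f.
Proof. by move=> ?; apply: RintegralZl => //; exact: bounded_measurable_integrable. Qed.

Lemma Rint_sum (n : nat) (F : nat -> R -> R) : (forall j, bounded_measurable (F j)) ->
  int (fun x => \sum_(j < n) F j x) = \sum_(j < n) int (F j).
Proof.
move=> bF; elim: n => [|n IH].
  rewrite big_ord0; under eq_fun do rewrite big_ord0.
  by rewrite Rintegral_cst// mul0r.
rewrite big_ord_recr/= -IH; under eq_fun do rewrite big_ord_recr /=.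
by rewrite RintD//; exact: bounded_measurable_sum.
Qed.

Lemma Rint_cst (a : R) : int (fun _ => a) = a * fine (m setT).
Proof. exact: Rintegral_cst. Qed.

Lemma Rint_indic (A : set R) : measurable A -> int (\1_A) = fine (m A).
Proof. by move=> mA; rewrite /Rintegral integral_indic// setIT. Qed.

Lemma Rint_setC (N : set R) f : measurable N -> m N = 0%E -> bounded_measurable f ->
  int f = Rintegral m (~` N) f.
Proof.
move=> mN N0 bf; rewrite /Rintegral (negligible_integral mN)// ?setTD//.
exact: bounded_measurable_integrable.
Qed.

Lemma le_Rint_null (N : set R) f g : measurable N -> m N = 0%E ->
  bounded_measurable f -> bounded_measurable g ->
  (forall x, ~ N x -> f x <= g x) -> int f <= int g.
Proof.
move=> mN N0 bf bg fg; rewrite (Rint_setC mN N0 bf) (Rint_setC mN N0 bg).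
have sub h : bounded_measurable h -> m.-integrable (~` N) (EFin \o h).
  move=> bh; apply: (integrableS measurableT) => //; first exact: measurableC.
  exact: bounded_measurable_integrable.
by apply: le_Rintegral; [exact: measurableC | exact: sub | exact: sub | exact: fg].
Qed.

Lemma le_Rint f g : bounded_measurable f -> bounded_measurable g ->
  (forall x, f x <= g x) -> int f <= int g.
Proof. by move=> bf bg fg; apply: (@le_Rint_null set0) => // x _; exact: fg. Qed.

Lemma Rint_gt0_null (N : set R) f : measurable N -> m N = 0%E -> m setT != 0%E ->
  bounded_measurable f -> (forall x, ~ N x -> 0 < f x) -> 0 < int f.
Proof.
move=> mN N0 mT bf f0.
have f_ge0 : 0 <= int f.
  rewrite -[leLHS](mul0r (fine (m setT))) -Rint_cst.
  by apply: le_Rint_null N0 _ _ _ => //; [exact: bounded_measurable_cst | move=> x /f0/ltW].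
rewrite lt_neqAle f_ge0 andbT; apply/negP => /eqP/esym f_eq0.
have mNC : measurable (~` N) by exact: measurableC.
have mf : measurable_fun (~` N) (EFin \o f).
  by apply/measurable_EFinP; apply: measurable_funS bf.1.
have : (\int[m]_(x in ~` N) `|(f x)%:E| = 0)%E.
  rewrite (eq_integral (fun x => (f x)%:E)); last first.
    by move=> x; rewrite inE => /f0 fx; rewrite gee0_abs// lee_fin ltW.
  have : Rintegral m (~` N) f = 0 by rewrite -Rint_setC.
  rewrite /Rintegral => fine0; rewrite -[LHS]fineK ?fine0//.
  apply: integrable_fin_num => //.
  apply: (integrableS measurableT) => //; exact: bounded_measurable_integrable.
move/(ae_eq_integral_abs m mNC mf) => [Z [mZ Z0 sub]].
have NZT : N `|` Z = setT.
  apply/seteqP; split=> // x _; have [Nx|Nx] := pselect (N x); [by left | right].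
  apply: sub => /= h; have /eqP := h Nx; rewrite /cst /=.
  by rewrite eqe gt_eqF// f0.
by move/eqP: mT; apply; rewrite -NZT -N0; exact: measureU0.
Qed.

End RealIntegral.

(** * Topological support versus absence of mass on the negative axis *)

Section Support.
Context {R : realType}.

Definition nonneg_carried (m : set R -> \bar R) : Prop := m [set x | x < 0] = 0%E.

Lemma measurable_neg : measurable [set x : R | x < 0].
Proof.
rewrite (_ : [set x | x < 0] = [set` `]-oo, (0 : R)[]); first exact: measurable_itv.
by apply/seteqP; split => x /=; rewrite in_itv.
Qed.

Lemma measurable_pos : measurable [set x : R | 0 < x].
Proof.
rewrite (_ : [set x | 0 < x] = [set` `](0 : R), +oo[]); first exact: measurable_itv.
by apply/seteqP; split => x /=; rewrite in_itv /= andbT.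
Qed.

Lemma le_Rint_nonneg (m : {finite_measure set R -> \bar R}) (f g : R -> R) :
  nonneg_carried m -> bounded_measurable f -> bounded_measurable g ->
  (forall x, 0 <= x -> f x <= g x) -> Rintegral m setT f <= Rintegral m setT g.
Proof.
move=> m0 bf bg fg; apply: (le_Rint_null measurable_neg m0) => // x /negP.
by rewrite -leNgt; exact: fg.
Qed.

Lemma Rint_gt0_nonneg (m : {finite_measure set R -> \bar R}) (f : R -> R) :
  nonneg_carried m -> m setT != 0%E -> bounded_measurable f ->
  (forall x, 0 <= x -> 0 < f x) -> 0 < Rintegral m setT f.
Proof.
move=> m0 mT bf f0; apply: (Rint_gt0_null measurable_neg m0) => // x /negP.
by rewrite -leNgt; exact: f0.
Qed.

(** A Lindelof argument: each point off the support lies in a null ball with rational centre and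
    radius, and there are countably many such balls. *)
Lemma msupport_nonneg_null (m : {measure set R -> \bar R}) :
  msupport m `<=` [set x | 0 <= x] -> nonneg_carried m.
Proof.
move=> supp.
(* Enumerates the null rational balls through codes of pairs (centre, radius). A number coding no
   pair, or coding a ball of nonzero measure, yields the empty set. *)
pose F (n : nat) : set R := if (@unpickle (rat * rat)%type n) is Some qr then
   (if m (ball (ratr qr.1 : R) (ratr qr.2)) == 0%E then ball (ratr qr.1 : R) (ratr qr.2) else set0)
   else set0.
have F0 n : m.-negligible (F n).
  rewrite /F; case: unpickle => [qr|]; last exact: negligible_set0.
  case: eqP => [h|_]; last exact: negligible_set0.
  by apply/negligibleP => //; exact: measurable_ball.
have [Z [mZ Z0 FZ]] := negligible_bigcup F0.
apply/eqP; rewrite -measure_le0 -Z0 le_measure ?inE//; first exact: measurable_neg.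
apply: (subset_trans _ FZ) => x /= x0.
have : ~ msupport m x by move=> /supp /=; rewrite leNgt x0.
rewrite /msupport /= => /existsNP[e /not_implyP[e0 /negP]]; rewrite -leNgt measure_le0 => me0.
(* A radius below [e / 2] lets a rational ball contain [x] and stay inside [ball x e]. *)
have [r /andP[r0 re]] : exists r : rat, (0 < (ratr r : R)) && (ratr r < e / 2).
  by have [|r] := @rat_in_itvoo R 0 (e / 2); [rewrite divr_gt0 | rewrite in_itv; exists r].
have [q /andP[xq qx]] : exists q : rat, (x - ratr r < (ratr q : R)) && (ratr q < x + ratr r).
  have [|q] := @rat_in_itvoo R (x - ratr r) (x + ratr r); last by rewrite in_itv; exists q.
  by rewrite ltrBlDr -addrA ltrDl addr_gt0.
have qr_e : ball (ratr q : R) (ratr r) `<=` ball x e.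
  move=> y; rewrite /ball /= !ltr_norml => /andP[h1 h2]; apply/andP; split; lra.
have ball0 : m (ball (ratr q : R) (ratr r)) == 0%E.
  apply/eqP; apply: (subset_measure0 _ _ qr_e) => //; try exact: measurable_ball.
  exact/eqP.
have FE : F (pickle (q, r)) = ball (ratr q : R) (ratr r).
  by rewrite /F pickleK; case: ifPn => // /negP.
exists (pickle (q, r)); first exact: I.
by rewrite FE /ball /= ltr_norml; apply/andP; split; lra.
Qed.

(** Reduces the support condition to compact intervals, on which the grid arguments below work: the
    ball of radius [- x / 2] about [x < 0] lies in [[2 x, x / 2]]. *)
Lemma null_itv_msupport (m : {measure set R -> \bar R}) :
  (forall a b : R, a < b -> b < 0 -> m [set` `[a, b]] = 0%E) ->
  msupport m `<=` [set x | 0 <= x].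
Proof.
move=> m0 x mx /=; rewrite leNgt; apply/negP => x0.
have /mx : 0 < - x / 2 by lra.
have : (m (ball x (- x / 2)%R) <= m [set` `[(2 * x)%R, (x / 2)%R]])%E.
  rewrite le_measure ?inE//; first exact: measurable_ball.
  by move=> y; rewrite /ball /= ltr_norml in_itv /= => /andP[h1 h2]; apply/andP; split; lra.
rewrite m0; [|lra|lra] => /le_lt_trans /[apply]; by rewrite ltxx.
Qed.

End Support.

(** * The Cauchy transform in real coordinates and the Schwarz-Pick estimate for its reciprocal *)

Section Transform.
Context {R : realType}.
Local Notation C := R[i].

Definition csqn (z : C) : R := complex.Re z ^+ 2 + complex.Im z ^+ 2.

Lemma csqnM (z w : C) : csqn (z * w) = csqn z * csqn w.
Proof. by case: z w => [a b] [c d]; rewrite /csqn /=; ring. Qed.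

Lemma csqn_gt0 (z : C) : z != 0 -> 0 < csqn z.
Proof.
case: z => a b; rewrite eq_complex /= negb_and /csqn /= => /orP[a0|b0].
  by rewrite ltr_pwDl ?sqr_ge0// exprn_even_gt0.
by rewrite ltr_wpDl ?sqr_ge0// exprn_even_gt0.
Qed.

Lemma csqnV (z : C) : csqn z^-1 = (csqn z)^-1.
Proof.
have [->|z0] := eqVneq z 0.
  by rewrite invr0 /csqn /= expr0n /= addr0 invr0.
apply: (mulfI (lt0r_neq0 (csqn_gt0 z0))); rewrite -csqnM !mulfV//.
  by rewrite /csqn /= expr1n expr0n /= addr0.
by rewrite lt0r_neq0// csqn_gt0.
Qed.

Lemma Re_le_csqn (z : C) (c : R) : 0 <= c -> csqn z <= c ^+ 2 -> complex.Re z <= c.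
Proof.
move=> c0 zc; rewrite leNgt; apply/negP => cz; move: zc; rewrite leNgt => /negP; apply.
by rewrite /csqn ltr_wpDr ?sqr_ge0// ltr_pXn2r ?nnegrE// (le_trans c0)// ltW.
Qed.

Lemma mul_le_sqr_mean (a b : R) : a * b <= ((a + b) / 2) ^+ 2.
Proof. by rewrite -subr_ge0 (_ : _ - _ = ((a - b) / 2) ^+ 2) ?sqr_ge0//; field. Qed.

Lemma ReB (z w : C) : complex.Re (z - w) = complex.Re z - complex.Re w.
Proof. by case: z w => [a b] [c d]. Qed.

Lemma ReV (z : C) : complex.Re z^-1 = complex.Re z / csqn z.
Proof. by case: z. Qed.

(** The Poisson integral of [m] at [u + i v] is [v / pi] times this quantity; without the factor [v]
    it may stay bounded as [v] tends to 0. *)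
Definition poisson (m : {measure set R -> \bar R}) (u v : R) : R :=
  Rintegral m setT (fun x => ((x - u) ^+ 2 + v ^+ 2)^-1).

Definition conj_poisson (m : {measure set R -> \bar R}) (u v : R) : R :=
  Rintegral m setT (fun x => (x - u) / ((x - u) ^+ 2 + v ^+ 2)).

(** For [v != 0] this is the squared modulus of the Cauchy transform,
    [G (u + i v) = - Q - i v P]. *)
Definition sqmod (m : {measure set R -> \bar R}) (u v : R) : R :=
  conj_poisson m u v ^+ 2 + (v * poisson m u v) ^+ 2.

Variable m : probability R R.

Local Notation P := (poisson m).
Local Notation Q := (conj_poisson m).
Local Notation D := (sqmod m).
Local Notation H u v := (rcauchy m (Complex u v)).

Lemma cauchy_transformE (u v : R) : v != 0 ->
  cauchy_transform m (Complex u v) = Complex (- Q u v) (- (v * P u v)).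
Proof.
move=> v0; rewrite /cauchy_transform /cint; congr Complex.
  rewrite -[RHS]mulN1r -RintZ; last exact: bounded_measurable_cauchy1.
  by apply: eq_Rintegral => x _ /=; rewrite subr0 -(opprB x u) sqrrN mulNr mulN1r.
rewrite -mulNr -RintZ; last exact: bounded_measurable_cauchy0.
by apply: eq_Rintegral => x _ /=; rewrite subr0 -(opprB x u) sqrrN -mulNr.
Qed.

Lemma probability_neq0 : m setT != 0%E.
Proof.
apply/eqP => m0; have /eqP : (1%E = 0%E :> \bar R) by rewrite -(probability_setT m).
by rewrite eqe oner_eq0.
Qed.

Lemma poisson_gt0 (u v : R) : v != 0 -> 0 < P u v.
Proof.
move=> v0; apply: (@Rint_gt0_null _ _ set0) => //.
- exact: probability_neq0.
- exact: bounded_measurable_cauchy0.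
- by move=> x _; rewrite invr_gt0 sqr_distD_gt0.
Qed.

Lemma sqmod_gt0 (u v : R) : v != 0 -> 0 < D u v.
Proof.
move=> v0; rewrite /sqmod ltr_wpDl ?sqr_ge0// exprn_even_gt0//=.
by rewrite mulf_neq0// gt_eqF// poisson_gt0.
Qed.

Lemma Re_rcauchy (u v : R) : v != 0 -> complex.Re (H u v) = - Q u v / D u v.
Proof. by move=> v0; rewrite /rcauchy cauchy_transformE//= !sqrrN. Qed.

Lemma Im_rcauchy (u v : R) : v != 0 -> complex.Im (H u v) = v * P u v / D u v.
Proof. by move=> v0; rewrite /rcauchy cauchy_transformE//= !sqrrN mulNr opprK. Qed.

Lemma Im_rcauchy_gt0 (u v : R) : 0 < v -> 0 < complex.Im (H u v).
Proof.
move=> v0; have v0' := lt0r_neq0 v0.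
by rewrite Im_rcauchy// !mulr_gt0// ?invr_gt0 ?poisson_gt0 ?sqmod_gt0.
Qed.

(* Writing [H = -1/F] with [F z = int 1/(x - z)], one has
   [H z' - H z = (z' - z) int 1/((x - z) (x - z')) / (F z * F z')]; AM-GM in the integrand then
   bounds the real part, because [Im H / v = int |x - z|^-2 / |F z|^2]. *)
Lemma Re_rcauchy_lipschitz (u v u' v' d : R) : 0 < v -> 0 < v' -> 0 <= d ->
  (u' - u) ^+ 2 + (v' - v) ^+ 2 <= d ^+ 2 ->
  complex.Re (H u' v') - complex.Re (H u v) <=
  d / 2 * (complex.Im (H u v) / v + complex.Im (H u' v') / v').
Proof.
move=> v0 v'0 d0 dle; have vn0 := lt0r_neq0 v0; have v'n0 := lt0r_neq0 v'0.
have D0 := sqmod_gt0 u vn0; have D'0 := sqmod_gt0 u' v'n0.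
pose F : C := Complex (Q u v) (v * P u v).
pose F' : C := Complex (Q u' v') (v' * P u' v').
have FD : csqn F = D u v by [].
have F'D : csqn F' = D u' v' by [].
have F0 : F != 0 by apply/eqP => F0; move: D0; rewrite -FD F0 /csqn /= expr0n /= addr0 ltxx.
have F'0 : F' != 0 by apply/eqP => F'0; move: D'0; rewrite -F'D F'0 /csqn /= expr0n /= addr0 ltxx.
pose k : C := (F * F')^-1.
pose g (x : R) : C := (Complex (x - u) (- v))^-1.
pose g' (x : R) : C := (Complex (x - u') (- v'))^-1.
have gE x : g x = Complex ((x - u) / ((x - u) ^+ 2 + v ^+ 2)) (v * ((x - u) ^+ 2 + v ^+ 2)^-1).
  by apply/eqP; rewrite eq_complex /= sqrrN mulNr opprK !eqxx.
have g'E x : g' x =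
    Complex ((x - u') / ((x - u') ^+ 2 + v' ^+ 2)) (v' * ((x - u') ^+ 2 + v' ^+ 2)^-1).
  by apply/eqP; rewrite eq_complex /= sqrrN mulNr opprK !eqxx.
have bP : bounded_measurable (fun x => ((x - u) ^+ 2 + v ^+ 2)^-1).
  exact: bounded_measurable_cauchy0.
have bP' : bounded_measurable (fun x => ((x - u') ^+ 2 + v' ^+ 2)^-1).
  exact: bounded_measurable_cauchy0.
have bQ : bounded_measurable (fun x => (x - u) / ((x - u) ^+ 2 + v ^+ 2)).
  exact: bounded_measurable_cauchy1.
have bQ' : bounded_measurable (fun x => (x - u') / ((x - u') ^+ 2 + v' ^+ 2)).
  exact: bounded_measurable_cauchy1.
have -> : complex.Re (H u' v') - complex.Re (H u v) = complex.Re (k * (F' - F)).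
  have -> : k * (F' - F) = F^-1 - F'^-1 by rewrite /k; field; rewrite F0 F'0.
  by rewrite !Re_rcauchy// ReB !ReV FD F'D !mulNr opprK addrC.
pose kernel (x : R) := complex.Re (k * (g' x - g x)).
have kernelE : kernel = (fun x =>
   complex.Re k * ((x - u') / ((x - u') ^+ 2 + v' ^+ 2)) +
   (- complex.Re k * ((x - u) / ((x - u) ^+ 2 + v ^+ 2)) +
   ((- complex.Im k * v') * ((x - u') ^+ 2 + v' ^+ 2)^-1 +
    (complex.Im k * v) * ((x - u) ^+ 2 + v ^+ 2)^-1))).
  by apply/funext => x; rewrite /kernel gE g'E; case: (k) => a b /=; ring.
have bkernel : bounded_measurable kernel.
  rewrite kernelE.
  apply: bounded_measurableD; first by apply: bounded_measurableZ.
  apply: bounded_measurableD; first by apply: bounded_measurableZ.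
  apply: bounded_measurableD; first by apply: bounded_measurableZ.
  by apply: bounded_measurableZ.
have -> : complex.Re (k * (F' - F)) = Rintegral m setT kernel.
  rewrite kernelE !RintD//; [|by do ?[exact: bounded_measurableZ|apply: bounded_measurableD]..].
  rewrite !RintZ// -!/(P _ _) -!/(Q _ _) /F /F'; case: (k) => a b /=; ring.
rewrite !Im_rcauchy//.
have -> : d / 2 * (v * P u v / D u v / v + v' * P u' v' / D u' v' / v') =
  Rintegral m setT (fun x => (d / 2 / D u v) * ((x - u) ^+ 2 + v ^+ 2)^-1 +
     (d / 2 / D u' v') * ((x - u') ^+ 2 + v' ^+ 2)^-1).
  rewrite RintD ?RintZ//; [|exact: bounded_measurableZ..].
  by rewrite -!/(P _ _); field; rewrite vn0 v'n0 !gt_eqF.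
apply: le_Rint => //; first by apply: bounded_measurableD; exact: bounded_measurableZ.
move=> x; rewrite /kernel.
set N := (x - u) ^+ 2 + v ^+ 2; set N' := (x - u') ^+ 2 + v' ^+ 2.
have N0 : 0 < N by exact: sqr_distD_gt0.
have N'0 : 0 < N' by exact: sqr_distD_gt0.
apply: Re_le_csqn.
  by rewrite addr_ge0// !mulr_ge0// invr_ge0// ltW.
have -> : g' x - g x = (Complex u' v' - Complex u v) * (g x * g' x).
  rewrite /g /g'; set z := Complex (x - u) _; set z' := Complex (x - u') _.
  have -> : Complex u' v' - Complex u v = z - z'.
    by rewrite /z /z'; apply/eqP; rewrite eq_complex /=; apply/andP; split; apply/eqP; ring.
  have z0 : z != 0 by rewrite eq_complex /= negb_and oppr_eq0 vn0 orbT.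
  have z'0 : z' != 0 by rewrite eq_complex /= negb_and oppr_eq0 v'n0 orbT.
  by field; rewrite z0 z'0.
rewrite !csqnM !csqnV csqnM FD F'D.
have -> : csqn (Complex (x - u) (- v)) = N by rewrite /csqn /= sqrrN.
have -> : csqn (Complex (x - u') (- v')) = N' by rewrite /csqn /= sqrrN.
(* In these terms the squared claim is [|z' - z|^2 A B <= d^2 ((A + B) / 2)^2], which is AM-GM. *)
set A := (D u v)^-1 * N^-1; set B := (D u' v')^-1 * N'^-1.
have A0 : 0 <= A by rewrite mulr_ge0// invr_ge0 ltW.
have B0 : 0 <= B by rewrite mulr_ge0// invr_ge0 ltW.
have -> : d / 2 / D u v * N^-1 + d / 2 / D u' v' * N'^-1 = d * ((A + B) / 2).
  by rewrite /A /B; ring.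
have -> : (D u v * D u' v')^-1 * (csqn (Complex u' v' - Complex u v) * (N^-1 * N'^-1)) =
   csqn (Complex u' v' - Complex u v) * (A * B).
  by rewrite /A /B invfM; ring.
rewrite exprMn; apply: ler_pM; [|exact: mulr_ge0|exact: dle|].
  by rewrite addr_ge0// sqr_ge0.
exact: mul_le_sqr_mean.
Qed.

End Transform.
(** Both Cauchy kernels are bounded and continuous in [x], so weak continuity applies to them. This
    supplies continuity at [t = 0], where the differential equation says nothing. *)
Lemma weakly_continuous_rcauchy (R : realType) (mu : R -> probability R R) (u v : R) :
  weakly_continuous mu -> v != 0 ->
  {within [set t : R | 0 <= t], continuous (fun t => complex.Re (rcauchy (mu t) (Complex u v)))} /\
  {within [set t : R | 0 <= t], continuous (fun t => complex.Im (rcauchy (mu t) (Complex u v)))}.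
Proof.
move=> wc v0.
have cP : {within [set t : R | 0 <= t], continuous (fun t => poisson (mu t) u v)}.
  apply: wc; first exact: continuous_cauchy0.
  by exists (v ^+ 2)^-1 => x; exact: cauchy0_bound.
have cQ : {within [set t : R | 0 <= t], continuous (fun t => conj_poisson (mu t) u v)}.
  apply: wc; first exact: continuous_cauchy1.
  by exists `|v|^-1 => x; exact: cauchy1_bound.
have cvP : {within [set t : R | 0 <= t], continuous (fun t => v * poisson (mu t) u v)}.
  by move=> t; apply: cvgM; [exact: cvg_cst | exact: cP].
have cD : {within [set t : R | 0 <= t], continuous (fun t => (sqmod (mu t) u v)^-1)}.
  move=> t; apply: cvgV; first by rewrite gt_eqF// sqmod_gt0.
  by apply: cvgD; rewrite ?expr2; apply: cvgM => //; [exact: cQ|exact: cQ|exact: cvP|exact: cvP].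
split.
  rewrite (_ : (fun t => _) = (fun t => - conj_poisson (mu t) u v * (sqmod (mu t) u v)^-1)).
    by move=> t; apply: cvgM; [apply: cvgN; exact: cQ | exact: cD].
  by apply/funext => t; rewrite Re_rcauchy.
rewrite (_ : (fun t => _) = (fun t => v * poisson (mu t) u v * (sqmod (mu t) u v)^-1)).
  by move=> t; apply: cvgM; [exact: cvP | exact: cD].
by apply/funext => t; rewrite Im_rcauchy.
Qed.

(** * Boundary behaviour over the negative axis, and grid sums of Poisson kernels *)

Section NonnegativeSupport.
Context {R : realType}.

(** Without mass on the negative axis, [x - u >= - r > 0] holds for almost every [x], so both Cauchy
    integrals are bounded, and the conjugate one is bounded away from 0, uniformly down to the
    axis. *)
Lemma rcauchy_boundary (m : probability R R) (l r : R) :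
  nonneg_carried m -> r < 0 ->
  exists c K : R, [/\ 0 < c, 0 < K & forall u v : R, l <= u <= r -> 0 < v <= 1 ->
    complex.Re (rcauchy m (Complex u v)) <= - c /\
    complex.Im (rcauchy m (Complex u v)) <= K * v].
Proof.
move=> m0 r0.
(* A minorant of the conjugate kernel valid for all admissible [u] and [v]: the numerator is least
   at [u = r], the denominator largest at [u = l], [v = 1]. *)
pose f (x : R) : R := (- r + 1 * x + 0 * x ^+ 2) / ((x - l) ^+ 2 + 1 ^+ 2).
have bf : bounded_measurable f by apply: bounded_measurable_quadratic; exact: oner_neq0.
have mT1 : fine (m setT) = 1 by rewrite probability_setT.
set g := Rintegral m setT f.
have g0 : 0 < g.
  apply: Rint_gt0_nonneg => //; [exact: probability_neq0|] => x x0.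
  by apply: mulr_gt0; [lra | rewrite invr_gt0 sqr_distD_gt0// oner_neq0].
pose A := (r ^+ 2)^-1; pose B := (- r)^-1.
have r2 : 0 < r ^+ 2 by rewrite exprn_even_gt0//= lt_eqF.
have A0 : 0 < A by rewrite invr_gt0.
have B0 : 0 < B by rewrite invr_gt0 oppr_gt0.
pose M := B ^+ 2 + A ^+ 2.
have M0 : 0 < M by rewrite addr_gt0// exprn_gt0.
(* From [g ^ 2 <= D <= M], [g <= Q] and [P <= A]: [Re H = - Q / D <= - g / M] and
   [Im H / v = P / D <= A / g ^ 2]. The bound [D <= M] uses [v <= 1]. *)
exists (g / M), (A / g ^+ 2); split; [exact: divr_gt0|by rewrite divr_gt0// exprn_gt0|].
move=> u v /andP[lu ur] /andP[v0 v1]; have vn0 := lt0r_neq0 v0.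
have P0 := poisson_gt0 m u vn0; have D0 := sqmod_gt0 m u vn0.
rewrite Re_rcauchy// Im_rcauchy//.
have gQ : g <= conj_poisson m u v.
  apply: le_Rint_nonneg => //; first exact: bounded_measurable_cauchy1.
  move=> x x0.
  rewrite /f (_ : - r + 1 * x + 0 * x ^+ 2 = x - r); last by ring.
  apply: ler_pM; [lra| |lra|]; first by rewrite invr_ge0 ltW// sqr_distD_gt0// oner_neq0.
  rewrite lef_pV2 ?posrE ?sqr_distD_gt0// ?oner_neq0//.
  by apply: lerD; rewrite ler_pXn2r ?nnegrE//; lra.
have QB : conj_poisson m u v <= B.
  rewrite -[leRHS]mulr1 -mT1 -(Rint_cst m).
  apply: le_Rint_nonneg => //; [exact: bounded_measurable_cauchy1|exact: bounded_measurable_cst|].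
  move=> x x0.
  rewrite ler_pdivrMr ?sqr_distD_gt0// mulrC ler_pdivlMr ?oppr_gt0//.
  by have := sqr_ge0 v; nra.
have PA : poisson m u v <= A.
  rewrite -[leRHS]mulr1 -mT1 -(Rint_cst m).
  apply: le_Rint_nonneg => //; [exact: bounded_measurable_cauchy0|exact: bounded_measurable_cst|].
  move=> x x0.
  rewrite lef_pV2 ?posrE ?sqr_distD_gt0//.
  by have := sqr_ge0 v; nra.
have DM : sqmod m u v <= M.
  have Q0 : 0 <= conj_poisson m u v by exact: le_trans (ltW g0) gQ.
  have vP0 : 0 <= v * poisson m u v by rewrite mulr_ge0// ltW.
  have vPA : v * poisson m u v <= A by rewrite (le_trans _ PA)// ler_piMl// ltW.
  by apply: lerD; rewrite lerXn2r ?nnegrE// ltW.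
have gD : g ^+ 2 <= sqmod m u v.
  rewrite /sqmod (le_trans (_ : _ <= conj_poisson m u v ^+ 2))//.
    by rewrite lerXn2r ?nnegrE ?(ltW g0)// (le_trans (ltW g0)).
  by rewrite lerDl sqr_ge0.
split.
  rewrite mulNr lerN2; apply: ler_pM; [exact: ltW|by rewrite invr_ge0 ltW|exact: gQ|].
  by rewrite lef_pV2.
rewrite -mulrA [leRHS]mulrC ler_pM2l//; apply: ler_pM => //; first exact: ltW.
  by rewrite invr_ge0 ltW.
by rewrite lef_pV2 ?posrE// exprn_gt0.
Qed.

(** A chain climbing by at most [h] per step cannot jump over [x], so some [X j] lies within [h]
    below [x], and its term alone reaches the bound. Backward steps do no harm. *)
Lemma chain_sum_ge (n : nat) (X Y : nat -> R) (h x : R) :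
  X 0%N <= x <= X n -> (forall j, (j < n)%N -> X j.+1 <= X j + h) ->
  (forall j, (j <= n)%N -> 0 < Y j <= h) ->
  (2 * h ^+ 2)^-1 <= \sum_(j < n.+1) ((x - X j) ^+ 2 + Y j ^+ 2)^-1.
Proof.
move=> xn Xh Yh.
have h0 : 0 < h by case/andP: (Yh 0%N isT) => /lt_le_trans; exact.
have [j jn /andP[jx xj]] : exists2 j, (j < n.+1)%N & X j <= x <= X j + h.
  elim: n xn Xh {Yh} => [|n IH] /andP[x0 xn] Xh.
    by exists 0%N => //; rewrite x0 (le_trans xn)// lerDl ltW.
  have [xXn|Xnx] := leP x (X n).
    have [||j jn jx] := IH; [by rewrite x0 | by move=> j /ltnW/Xh | by exists j => //; exact: ltnW].
  by exists n; [exact: ltnW | rewrite ltW//= (le_trans xn)// Xh].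
have t0 (i : 'I_n.+1) : 0 < ((x - X i) ^+ 2 + Y i ^+ 2).
  by rewrite sqr_distD_gt0// lt0r_neq0//; case/andP: (Yh i (ltn_ord i)).
rewrite (bigD1 (Ordinal jn))//= -[leLHS]addr0; apply: lerD.
  have /andP[Y0 Y1] := Yh j jn.
  by rewrite lef_pV2 ?posrE ?mulr_gt0 ?exprn_gt0 ?(t0 (Ordinal jn))//; nra.
by apply: sumr_ge0 => i _; rewrite invr_ge0 ltW.
Qed.

Lemma archi_le0 (a K : R) (n0 : nat) :
  (forall n, (n0 < n)%N -> n%:R * a <= K) -> a <= 0.
Proof.
move=> H; rewrite leNgt; apply/negP => a0.
pose n := (maxn n0 (Num.bound (`|K| / a))).+1.
have /H : (n0 < n)%N by rewrite /n ltnS leq_maxl.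
rewrite leNgt => /negP; apply; rewrite -ltr_pdivrMr//.
apply: (@le_lt_trans _ _ (`|K| / a)); first by rewrite ler_pM2r ?invr_gt0// ler_norm.
apply: (lt_trans (archi_boundP _)); first by rewrite divr_ge0// ltW.
by rewrite ltr_nat ltnS leq_maxr.
Qed.

(* The hypothesis bounds the Poisson integral of [-x m(dx)] from above.  Summed over the grid of
   mesh and height [h] on [[a, b]], the integrand is at most [O(1/h) + b/(2 h^2) 1_[a,b]]. *)
Lemma poisson_moment_ge0_null (m : {finite_measure set R -> \bar R}) (a b : R) :
  (forall u v : R, 0 < v -> 0 <= Rintegral m setT (fun x => x / ((x - u) ^+ 2 + v ^+ 2))) ->
  a < b -> b < 0 -> m [set` `[a, b]] = 0%E.
Proof.
move=> mom ab b0; set I := [set` `[a, b]]; have mI : measurable I by exact: measurable_itv.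
have mIfin : m I \is a fin_num by exact: fin_num_measure.
suff mI0 : fine (m I) <= 0.
  rewrite -(fineK mIfin); congr EFin; apply/eqP; rewrite eq_le mI0/=.
  by rewrite fine_ge0.
set T := fine (m setT).
have T0 : 0 <= T by rewrite fine_ge0.
suff H n : (0 < n)%N -> n%:R * (fine (m I) * b ^+ 2) <= 4 * T * (b - a) ^+ 2.
  have /archi_le0 : forall n, (0 < n)%N -> n%:R * (fine (m I) * b ^+ 2) <= 4 * T * (b - a) ^+ 2 by [].
  by rewrite pmulr_lle0// exprn_even_gt0//= lt_eqF.
move=> n0; pose h := (b - a) / n%:R.
have nR : 0 < n%:R :> R by rewrite ltr0n.
have h0 : 0 < h by rewrite divr_gt0// subr_gt0.
have hn0 := lt0r_neq0 h0.
pose f (j : nat) (x : R) := x / ((x - (a + j%:R * h)) ^+ 2 + h ^+ 2).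
have bf j : bounded_measurable (f j).
  rewrite (_ : f j = fun x => (0 + 1 * x + 0 * x ^+ 2) / ((x - (a + j%:R * h)) ^+ 2 + h ^+ 2)).
    exact: bounded_measurable_quadratic.
  by apply/funext => x; rewrite /f; congr (_ / _); ring.
have sum0 : 0 <= Rintegral m setT (fun x => \sum_(j < n.+1) f j x).
  by rewrite Rint_sum//; apply: sumr_ge0 => j _; exact: mom.
(* On [I] the sum of kernels is at least [1 / (2 h ^ 2)] and is multiplied by [x <= b < 0]. Off [I]
   each of the [n + 1] terms is at most [- 1 / b], because every grid point is at most [b]. *)
have : 0 <= n.+1%:R * (- b)^-1 * T + b * (2 * h ^+ 2)^-1 * fine (m I).
  apply: (le_trans sum0).
  rewrite -Rint_cst -Rint_indic// -RintZ; last exact: bounded_measurable_indic.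
  rewrite -RintD; [|exact: bounded_measurable_cst|by apply: bounded_measurableZ; exact: bounded_measurable_indic].
  apply: le_Rint; first exact: bounded_measurable_sum.
    apply: bounded_measurableD; first exact: bounded_measurable_cst.
    by apply: bounded_measurableZ; exact: bounded_measurable_indic.
  move=> x.
  have N0 j : 0 < (x - (a + j%:R * h)) ^+ 2 + h ^+ 2 by exact: sqr_distD_gt0.
  rewrite indicE; case: (boolP (x \in I)) => [|_].
    rewrite inE /I /= in_itv /= => /andP[ax xb]; rewrite mulr1.
    have H : (2 * h ^+ 2)^-1 <= \sum_(j < n.+1) ((x - (a + j%:R * h)) ^+ 2 + h ^+ 2)^-1.
      apply: (@chain_sum_ge n (fun j => a + j%:R * h) (fun=> h)).
      - by rewrite mul0r addr0 ax /h mulrC divfK ?lt0r_neq0// addrC subrK.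
      - by move=> j _; rewrite -natr1 mulrDl mul1r addrA.
      - by move=> j _; rewrite h0 lexx.
    rewrite /f -mulr_sumr -[leLHS]add0r; apply: lerD.
      by rewrite mulr_ge0// invr_ge0 oppr_ge0 ltW.
    apply: (le_trans (_ : _ <= b * \sum_(j < n.+1) ((x - (a + j%:R * h)) ^+ 2 + h ^+ 2)^-1)).
      by rewrite ler_wpM2r// sumr_ge0// => j _; rewrite invr_ge0 ltW.
    by rewrite ler_wnM2l// ltW.
  rewrite mulr0 addr0.
  have -> : n.+1%:R / - b = \sum_(j < n.+1) (- b)^-1 by rewrite sumr_const card_ord mulr_natl.
  apply: ler_sum => j _; rewrite ler_pdivrMr//.
  have jb : a + j%:R * h <= b.
    rewrite -lerBrDl /h mulrA ler_pdivrMr// mulrC ler_pM2l ?subr_gt0// ler_nat.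
    by rewrite -ltnS.
  have [x0|x0] := leP x 0.
    by rewrite (le_trans x0)// mulr_ge0// ?ltW// invr_gt0 oppr_gt0.
  rewrite mulrC ler_pdivlMr ?oppr_gt0//; move: jb; set u := a + _ => ub.
  by have := sqr_ge0 h; nra.
set E := b * (2 * h ^+ 2)^-1 * fine (m I) => E0.
have d0 : 0 < b - a by rewrite subr_gt0.
have bn0 : b != 0 by rewrite lt_eqF.
(* With [n + 1 <= 2 n], the right side grows like [n] while the factor [h ^ -2] in [E] grows like
   [n ^ 2]; so the mass of [I] is [O(1 / n)]. *)
have EE : - E <= 2 * n%:R / (- b) * T.
  apply: (@le_trans _ _ (n.+1%:R / (- b) * T)); first by lra.
  rewrite ler_wpM2r// ler_wpM2r ?invr_ge0 ?oppr_ge0 ?(ltW b0)//.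
  by rewrite -natr1 mulr_natl mulr2n lerD2l ler1n.
have -> : n%:R * (fine (m I) * b ^+ 2) = (- b * 2 * (b - a) ^+ 2 / n%:R) * (- E).
  by rewrite /E /h; field; rewrite !lt0r_neq0.
have -> : 4 * T * (b - a) ^+ 2 = (- b * 2 * (b - a) ^+ 2 / n%:R) * (2 * n%:R / (- b) * T).
  by field; rewrite bn0 lt0r_neq0.
have nb0 : 0 <= - b by rewrite oppr_ge0 ltW.
have nV0 : 0 <= n%:R^-1 :> R by rewrite invr_ge0 ltW.
apply: ler_wpM2l EE; apply: mulr_ge0 nV0; apply: mulr_ge0 (sqr_ge0 _).
by rewrite mulr_ge0.
Qed.

End NonnegativeSupport.

(** * The flow of the vector field in real coordinates: height and argument along trajectories *)

Section Flow.
Context {R : realType}.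
Implicit Types (tau : {finite_measure set R -> \bar R}) (X Y : R -> R).

Lemma bounded_measurable_vf_Im (u v : R) : v != 0 ->
  bounded_measurable (fun x => (1 + x ^+ 2) / ((x - u) ^+ 2 + v ^+ 2)).
Proof.
move=> v0.
rewrite (_ : (fun x => _) = (fun x => (1 + 0 * x + 1 * x ^+ 2) / ((x - u) ^+ 2 + v ^+ 2))).
  exact: bounded_measurable_quadratic.
by apply/funext => x; congr (_ / _); ring.
Qed.

Lemma bounded_measurable_vf_Re (u v : R) : v != 0 ->
  bounded_measurable (fun x => ((1 + x * u) * (x - u) - x * v ^+ 2) / ((x - u) ^+ 2 + v ^+ 2)).
Proof.
move=> v0.
rewrite (_ : (fun x => _) = (fun x => (- u + (1 - u ^+ 2 - v ^+ 2) * x + u * x ^+ 2) /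
    ((x - u) ^+ 2 + v ^+ 2))).
  exact: bounded_measurable_quadratic.
by apply/funext => x; congr (_ / _); ring.
Qed.

Lemma Im_vector_field (gamma : R) tau (u v : R) : v != 0 ->
  complex.Im (vector_field gamma tau (Complex u v)) =
  v * Rintegral tau setT (fun x => (1 + x ^+ 2) / ((x - u) ^+ 2 + v ^+ 2)).
Proof.
move=> v0; rewrite /vector_field /cint /= oppr0 add0r -RintZ; last exact: bounded_measurable_vf_Im.
apply: eq_Rintegral => x _ /=.
by have := sqr_distD_gt0 u x v0 => N0; field; exact: lt0r_neq0.
Qed.

Lemma Re_vector_field (gamma : R) tau (u v : R) : v != 0 ->
  complex.Re (vector_field gamma tau (Complex u v)) =
  - gamma + Rintegral tau setT
     (fun x => ((1 + x * u) * (x - u) - x * v ^+ 2) / ((x - u) ^+ 2 + v ^+ 2)).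
Proof.
move=> v0; rewrite /vector_field /cint /=; congr (_ + _).
apply: eq_Rintegral => x _ /=.
by have := sqr_distD_gt0 u x v0 => N0; field; exact: lt0r_neq0.
Qed.

(** A trajectory [X + i Y] of [dH/dt = A(H)] in the upper half-plane; the integrands are the real
    part of [(1 + x w) / (x - w)] and its imaginary part divided by [Y]. The equation holds for
    [t > 0] only, hence the separate continuity clauses. *)
Definition flow_line (gamma : R) tau X Y : Prop :=
  [/\ {within [set t : R | 0 <= t], continuous X},
      {within [set t : R | 0 <= t], continuous Y},
      forall t : R, 0 <= t -> 0 < Y t,
      forall t : R, 0 < t -> is_derive t (1 : R) X (- gamma + Rintegral tau setT
        (fun x => ((1 + x * X t) * (x - X t) - x * Y t ^+ 2) / ((x - X t) ^+ 2 + Y t ^+ 2))) &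
      forall t : R, 0 < t -> is_derive t (1 : R) Y (Y t * Rintegral tau setT
        (fun x => (1 + x ^+ 2) / ((x - X t) ^+ 2 + Y t ^+ 2)))].

Lemma associated_pair_flow_line (mu : R -> probability R R) (gamma : R) tau (u v : R) :
  weakly_continuous mu -> associated_pair mu gamma tau -> 0 < v ->
  let X t := complex.Re (rcauchy (mu t) (Complex u v)) in
  let Y t := complex.Im (rcauchy (mu t) (Complex u v)) in
  [/\ flow_line gamma tau X Y, X 0 = u & Y 0 = v].
Proof.
move=> wc ap v0; have vn0 := lt0r_neq0 v0; have [cX cY] := weakly_continuous_rcauchy u wc vn0.
have [H0 dH] := ap (Complex u v) vn0.
have HE t : rcauchy (mu t) (Complex u v) =
    Complex (complex.Re (rcauchy (mu t) (Complex u v))) (complex.Im (rcauchy (mu t) (Complex u v))).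
  by case: rcauchy.
have Yn0 t : complex.Im (rcauchy (mu t) (Complex u v)) != 0.
  by rewrite lt0r_neq0// Im_rcauchy_gt0.
split; [|by rewrite H0|by rewrite H0].
split => // t t0; first exact: Im_rcauchy_gt0.
  by have [dX _] := dH _ t0; move: dX; rewrite [in X in is_derive _ _ _ X]HE Re_vector_field.
by have [_ dY] := dH _ t0; move: dY; rewrite [in X in is_derive _ _ _ X]HE Im_vector_field.
Qed.

Lemma mean_value_ge (f df : R -> R) (a b k : R) : 0 <= a <= b ->
  {within [set t : R | 0 <= t], continuous f} ->
  (forall t : R, a < t < b -> is_derive t (1 : R) f (df t)) ->
  (forall t, a < t < b -> k <= df t) -> k * (b - a) <= f b - f a.
Proof.
move=> /andP[a0]; rewrite le_eqVlt => /predU1P[->|ab] cf fdf dfk; first by rewrite !subrr mulr0.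
have fdf' t : t \in `]a, b[ -> is_derive t (1 : R) f (df t) by rewrite in_itv; exact: fdf.
have cf' : {within `[a, b], continuous f}.
  apply: continuous_subspaceW cf => t /=; rewrite in_itv /= => /andP[+ _].
  exact: le_trans.
have [c cab ->] := MVT ab fdf' cf'.
by rewrite ler_pM2r ?subr_gt0// dfk//; move: cab; rewrite in_itv.
Qed.

(** The integrand in [Y' / Y] is nonnegative, so trajectories never descend; a height bound at the
    final time then holds at all earlier times. *)
Lemma flow_line_Im_ndecr (gamma : R) tau X Y (s t : R) :
  flow_line gamma tau X Y -> 0 <= s <= t -> Y s <= Y t.
Proof.
move=> [_ cY Y0 _ dY] /andP[s0 st]; rewrite -subr_ge0 -[leLHS](mul0r (t - s)).
have tpos r : s < r < t -> 0 < r by case/andP => /(le_lt_trans s0).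
apply: (@mean_value_ge Y _ s t 0 _ cY (fun r sr => dY r (tpos r sr))); first by rewrite s0.
move=> r /tpos r0; rewrite mulr_ge0 ?(ltW (Y0 _ (ltW r0)))//; apply: Rintegral_ge0 => x _.
by rewrite mulr_ge0 ?addr_ge0 ?sqr_ge0// invr_ge0 addr_ge0 ?sqr_ge0.
Qed.

(** Discarding the null set [x <= 0] leaves an integral over the positive axis, where [1/x] is
    integrable and dominates [f]. *)
Lemma Rint_le_inv (gamma : R) tau (f : R -> R) :
  nonneg_carried tau -> tau [set 0] = 0%E ->
  (\int[tau]_(x in [set x : R | (0 < x)%R]) (x^-1)%R%:E < +oo)%E ->
  (\int[tau]_(x in [set x : R | (0 < x)%R]) (x^-1)%R%:E <= gamma%:E)%E ->
  bounded_measurable f -> (forall x : R, 0 < x -> f x <= x^-1) ->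
  Rintegral tau setT f <= gamma.
Proof.
move=> neg0 zero0 fin leg bf fle.
have mpos := @measurable_pos R.
have mN : measurable ([set x : R | x < 0] `|` [set 0]).
  by apply: measurableU => //; exact: measurable_neg.
have N0 : tau ([set x : R | x < 0] `|` [set 0]) = 0%E.
  by rewrite -neg0; apply: measureU0 => //; exact: measurable_neg.
have NC : ~` ([set x : R | x < 0] `|` [set 0]) = [set x : R | 0 < x].
  apply/seteqP; split => x /=.
    move=> h; rewrite lt_neqAle leNgt; apply/andP; split; apply/negP.
      by move=> /eqP x0; apply: h; right.
    by move=> x0; apply: h; left.
  by move=> x0 [|x0']; [rewrite ltNge ltW|move: x0; rewrite x0' ltxx].
rewrite (Rint_setC mN N0 bf) NC.
have inv_ge0 : (0 <= \int[tau]_(x in [set x : R | (0 < x)%R]) (x^-1)%R%:E)%E.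
  by apply: integral_ge0 => x /= x0; rewrite lee_fin invr_ge0 ltW.
have invfin : (\int[tau]_(x in [set x : R | (0 < x)%R]) (x^-1)%R%:E)%E \is a fin_num.
  by rewrite ge0_fin_numE.
have intinv : tau.-integrable [set x : R | 0 < x] (EFin \o (fun x : R => x^-1)).
  apply/integrableP; split.
    apply/measurable_EFinP; apply: open_continuous_measurable_fun.
      exact: open_gt.
    by move=> x; rewrite inE /= => x0; apply: cvgV => //; rewrite gt_eqF.
  rewrite (eq_integral (fun x : R => (x^-1)%R%:E)) // => x; rewrite inE /= => x0.
  by rewrite ger0_norm// invr_ge0 ltW.
apply: (@le_trans _ _ (Rintegral tau [set x : R | 0 < x] (fun x => x^-1))).
  apply: le_Rintegral => //.
  by apply: (integrableS measurableT) => //; exact: bounded_measurable_integrable.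
by rewrite -lee_fin /Rintegral fineK.
Qed.

Lemma is_derive_div (f g : R -> R) (t df dg : R) : g t != 0 ->
  is_derive t (1 : R) f df -> is_derive t (1 : R) g dg ->
  is_derive t (1 : R) (fun s => f s / g s) ((df * g t - f t * dg) / g t ^+ 2).
Proof.
move=> g0 hf hg; have hV := is_deriveV g0 hg.
have -> : (fun s => f s / g s) = f * (fun s => (g s)^-1) by apply/funext.
have h := is_deriveM hf hV.
apply: (is_derive_eq h).
by rewrite /GRing.scale /=; field.
Qed.

(* The ratio [X / Y] is the cotangent of the argument, and the kernel of its derivative is at most
   [1/x]: [1/x - (x (1 - u^2 - v^2) - 2 u) / ((x - u)^2 + v^2)
   = (1 + x^2) (u^2 + v^2) / (x ((x - u)^2 + v^2))]. *)
Lemma flow_line_arg_ndecr (gamma : R) tau X Y (t : R) :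
  nonneg_carried tau -> tau [set 0] = 0%E ->
  (\int[tau]_(x in [set x : R | (0 < x)%R]) (x^-1)%R%:E < +oo)%E ->
  (\int[tau]_(x in [set x : R | (0 < x)%R]) (x^-1)%R%:E <= gamma%:E)%E ->
  flow_line gamma tau X Y -> 0 <= t -> X t * Y 0 <= X 0 * Y t.
Proof.
move=> neg0 zero0 fin leg [cX cY Y0 dX dY] t0.
have Yn0 s : 0 <= s -> Y s != 0 by move=> /Y0; exact: lt0r_neq0.
pose q s := - X s / Y s.
have cq : {within [set t : R | 0 <= t], continuous q}.
  apply/subspace_continuousP => s /= s0; apply: cvgM.
    by apply: cvgN; exact: (subspace_continuousP _ _).1 cX _ s0.
  apply: cvgV; first exact: Yn0.
  exact: (subspace_continuousP _ _).1 cY _ s0.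
have dq s (s0 : 0 < s) :=
  is_derive_div (Yn0 _ (ltW s0)) (is_deriveN (dX _ s0)) (dY _ s0).
have : 0 * (t - 0) <= q t - q 0.
  have [->|tn0] := eqVneq t 0; first by rewrite !subrr mulr0.
  apply: (mean_value_ge _ cq (fun s st => dq s (andP st).1)) => //; first by rewrite lexx.
  move=> s /andP[s0 _]; rewrite divr_ge0 ?sqr_ge0//.
  set u := X s; set v := Y s; have v0 : 0 < v by exact/Y0/ltW.
  have vn0 := lt0r_neq0 v0.
  have bIm := bounded_measurable_vf_Im u vn0; have bRe := bounded_measurable_vf_Re u vn0.
  set A := Rintegral _ _ _; set B := Rintegral _ _ _.
  rewrite -/A -/B in bIm bRe *.
  (* The numerator of the derivative of [- X / Y] is [v * (gamma - (A - u * B))], and [A - u * B] is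
     the integral of a single kernel lying below [1/x]. *)
  have : A + (- u) * B <= gamma.
    rewrite /A /B -RintZ// -RintD//; last exact: bounded_measurableZ.
    apply: (Rint_le_inv neg0 zero0 fin leg).
      by apply: bounded_measurableD => //; exact: bounded_measurableZ.
    move=> x x0; rewrite -subr_ge0.
    rewrite (_ : _ - _ = (1 + x ^+ 2) * (u ^+ 2 + v ^+ 2) / (x * ((x - u) ^+ 2 + v ^+ 2))).
      by rewrite divr_ge0 ?mulr_ge0 ?addr_ge0 ?sqr_ge0// ltW.
    by field; rewrite !lt0r_neq0// sqr_distD_gt0.
  rewrite (_ : (- X) s = - u)// => AB.
  rewrite (_ : _ - _ = v * (gamma - (A + - u * B))); last by ring.
  by rewrite mulr_ge0 ?subr_ge0 ?(ltW v0).
rewrite mul0r subr_ge0 /q !mulNr lerN2 ler_pdivrMr ?Y0// mulrAC ler_pdivlMr ?Y0//.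
Qed.

End Flow.

(** * From the generator to the support of [mu t], and from [mu T] to the support of [tau] *)

Section Generator.
Context {R : realType}.
Implicit Types (mu : R -> probability R R) (tau : {finite_measure set R -> \bar R}).

(** With [H = (- Q + i v P) / D], monotonicity of the argument reads [Q + u P >= 0], and [Q + u P]
    is the integral of [x / ((x - u)^2 + v^2)], the moment that excludes negative mass. *)
Lemma generator_msupport mu (gamma : R) tau (t : R) :
  weakly_continuous mu -> associated_pair mu gamma tau ->
  nonneg_carried tau -> tau [set 0] = 0%E ->
  (\int[tau]_(x in [set x : R | (0 < x)%R]) (x^-1)%R%:E < +oo)%E ->
  (\int[tau]_(x in [set x : R | (0 < x)%R]) (x^-1)%R%:E <= gamma%:E)%E ->
  0 <= t -> msupport (mu t) `<=` [set x | 0 <= x].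
Proof.
move=> wc ap neg0 zero0 fin leg t0; apply: null_itv_msupport => a b.
apply: (@poisson_moment_ge0_null _ (mu t)) => u v v0; have vn0 := lt0r_neq0 v0.
have [fl X0 Y0] := associated_pair_flow_line u wc ap v0.
have := flow_line_arg_ndecr neg0 zero0 fin leg fl t0; rewrite X0 Y0.
rewrite Re_rcauchy// Im_rcauchy//.
set P := poisson _ _ _; set Q := conj_poisson _ _ _; set D := sqmod _ _ _ => h.
have D0 : 0 < D by exact: sqmod_gt0.
have -> : (fun x => x / ((x - u) ^+ 2 + v ^+ 2)) = (fun x =>
    (x - u) / ((x - u) ^+ 2 + v ^+ 2) + u * ((x - u) ^+ 2 + v ^+ 2)^-1).
  by apply/funext => x; ring.
have b0 := bounded_measurable_cauchy0 u vn0; have b1 := bounded_measurable_cauchy1 u vn0.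
rewrite RintD// ?RintZ//; last exact: bounded_measurableZ.
rewrite -/(conj_poisson _ _ _) -/(poisson _ _ _) -/P -/Q.
have : 0 <= (v / D) * (Q + u * P).
  rewrite -[leRHS](_ : u * (v * P / D) - - Q / D * v = _); last by ring.
  by rewrite subr_ge0.
by rewrite pmulr_rge0// divr_gt0.
Qed.

Lemma sqr_sub_le (x y : R) : 0 <= x -> x <= y -> (y - x) ^+ 2 <= y ^+ 2.
Proof. by move=> x0 xy; rewrite lerXn2r ?nnegrE; lra. Qed.

Lemma within_continuous_sum (A : set R) (n : nat) (F : nat -> R -> R) :
  (forall j, {within A, continuous (F j)}) ->
  {within A, continuous (fun t => \sum_(j < n) F j t)}.
Proof.
move=> cF; elim: n => [|n IH].
  rewrite (_ : (fun t => _) = fun=> 0); first exact: cst_continuous.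
  by apply/funext => t; rewrite big_ord0.
rewrite (_ : (fun t => _) = fun t => \sum_(j < n) F j t + F n t).
  by move=> t; apply: cvgD; [exact: IH | exact: cF].
by apply/funext => t; rewrite big_ord_recr.
Qed.

Lemma within_continuous_near (f : R -> R) (s e : R) :
  {within [set t : R | 0 <= t], continuous f} -> 0 <= s -> 0 < e ->
  exists2 d, 0 < d & forall t, 0 <= t -> `|t - s| < d -> `|f t - f s| < e.
Proof.
move=> /subspace_continuousP cf s0; move: (cf s s0) => /cvgrPdist_lt /[apply].
rewrite /prop_near1 /within /= => /nbhs_ballP[d /= d0 H].
exists d => // t t0 ts; rewrite distrC; apply: (H t) => //.
by rewrite /ball /= distrC.
Qed.

Lemma within_continuous0_near (f : R -> R) (e : R) :
  {within [set t : R | 0 <= t], continuous f} -> 0 < e ->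
  exists2 s, 0 < s & forall t, 0 <= t <= s -> `|f t - f 0| <= e.
Proof.
move=> cf e0; have [d d0 H] := within_continuous_near cf (lexx 0) e0.
exists (d / 2); first by rewrite divr_gt0.
by move=> t /andP[t0 td]; apply/ltW/H => //; rewrite subr0 ger0_norm//; lra.
Qed.

(* If [tau] charged [[a, b]], the mean over a grid of mesh and height [h] of the increment of [Im H]
   on [[0, s0]] would be of order [s0 tau[a, b]], whereas the support of [mu T] makes it [O(h)]. *)
Lemma generator_null_itv mu (gamma : R) tau (T a b : R) :
  weakly_continuous mu -> associated_pair mu gamma tau ->
  0 < T -> nonneg_carried (mu T) -> a < b -> b < 0 -> tau [set` `[a, b]] = 0%E.
Proof.
move=> wc ap T0 supp ab b0.
(* The grid lives on a larger interval, still on the negative axis, so that its images keep covering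
   [[a, b]] for a short time. *)
pose l := a - 1; pose r := b / 2.
have r0 : r < 0 by rewrite /r; lra.
have lr : l < r by rewrite /l /r; lra.
have [c0 [C [_ C0 bd]]] := rcauchy_boundary l supp r0.
pose X s u v := complex.Re (rcauchy (mu s) (Complex u v)).
pose Y s u v := complex.Im (rcauchy (mu s) (Complex u v)).
have Fl u v : 0 < v -> [/\ flow_line gamma tau (fun s => X s u v) (fun s => Y s u v),
   X 0 u v = u & Y 0 u v = v].
  exact: associated_pair_flow_line.
have Y_le s u v : 0 <= s <= T -> l <= u <= r -> 0 < v <= 1 -> Y s u v <= C * v.
  move=> /andP[s0 sT] lur v01; have [|fl _ _] := Fl u v; first by case/andP: v01.
  apply: (le_trans (_ : _ <= Y T u v)); last by have [] := bd u v lur v01.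
  by apply: (flow_line_Im_ndecr fl); rewrite s0.
have Y_ge s u v : 0 <= s -> 0 < v -> v <= Y s u v.
  move=> s0 v0; have [fl _ Y0] := Fl u v v0; rewrite -[leLHS]Y0.
  by apply: (flow_line_Im_ndecr fl); rewrite lexx.
have X_lip s u v u' v' d : 0 <= s <= T -> l <= u <= r -> 0 < v <= 1 -> l <= u' <= r ->
    0 < v' <= 1 -> 0 <= d -> (u' - u) ^+ 2 + (v' - v) ^+ 2 <= d ^+ 2 ->
    X s u' v' <= X s u v + C * d.
  move=> sT lu v1 lu' v'1 d0 dd; have /andP[v0 _] := v1; have /andP[v'0 _] := v'1.
  rewrite -lerBlDl; apply: (le_trans (Re_rcauchy_lipschitz _ v0 v'0 d0 dd)).
  have -> : C * d = d / 2 * (C + C) by field.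
  rewrite ler_wpM2l ?divr_ge0//; apply: lerD; rewrite ler_pdivrMr//; exact: Y_le.
(* Half of each gap [a - l = 1] and [r - b = - b / 2]: one [rho] pays for the displacement up to
   time [s0], the other for the change of height from [d] to [h]. *)
pose rho := Num.min (2^-1) (- b / 4).
have rho0 : 0 < rho by rewrite lt_min; apply/andP; split; lra.
have rho1 : rho <= 2^-1 by rewrite ge_min lexx.
have rho2 : rho <= - b / 4 by rewrite ge_min lexx orbT.
(* The end trajectories are followed from the fixed height [d] rather than from [h], so that the
   time [s0] does not depend on the mesh. *)
pose d := Num.min 1 (rho / C).
have d0 : 0 < d by rewrite lt_min ltr01 divr_gt0.
have d1 : d <= 1 by rewrite ge_min lexx.
have dC : C * d <= rho by rewrite mulrC -ler_pdivlMr// ge_min lexx orbT.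
have [[cl _ _ _ _] Xl0 _] := Fl l d d0; have [[cr _ _ _ _] Xr0 _] := Fl r d d0.
have [s1 s10 nearl] := within_continuous0_near cl rho0.
have [s2 s20 nearr] := within_continuous0_near cr rho0.
pose s0 := Num.min T (Num.min s1 s2).
have s00 : 0 < s0 by rewrite !lt_min T0 s10.
have s0T : s0 <= T by rewrite ge_min lexx.
have s0s1 : s0 <= s1 by rewrite !ge_min lexx orbT.
have s0s2 : s0 <= s2 by rewrite !ge_min lexx !orbT.
set I := [set` `[a, b]]; have mI : measurable I by exact: measurable_itv.
have tIfin : tau I \is a fin_num by exact: fin_num_measure.
suff tI0 : fine (tau I) <= 0.
  rewrite -(fineK tIfin); congr EFin; apply/eqP; rewrite eq_le tI0/=.
  by rewrite fine_ge0.
set m := fine (tau I).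
suff H n : (Num.bound ((r - l) / d) < n)%N -> n%:R * (m * s0) <= 4 * C ^+ 3 * (r - l) ^+ 2.
  by have := archi_le0 H; rewrite pmulr_lle0.
move=> nb; pose h := (r - l) / n%:R.
have rl0 : 0 < r - l by rewrite subr_gt0.
have n0 : 0 < n%:R :> R by rewrite ltr0n (leq_trans _ nb).
have h0 : 0 < h by rewrite divr_gt0.
have hd : h <= d.
  rewrite /h ler_pdivrMr// mulrC -ler_pdivrMr//.
  by rewrite ltW// (lt_le_trans (archi_boundP _)) ?divr_ge0 ?(ltW rl0) ?(ltW d0)// ler_nat ltnW.
have h1 : 0 < h <= 1 by rewrite h0 (le_trans hd).
have d01 : 0 < d <= 1 by rewrite d0.
pose p (j : nat) := l + j%:R * h.
have nh : n%:R * h = r - l by rewrite /h mulrC divfK// lt0r_neq0.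
have lpr j : (j <= n)%N -> l <= p j <= r.
  move=> jn; rewrite lerDl mulr_ge0 ?ler0n ?(ltW h0)//= -lerBrDl -nh.
  by rewrite ler_pM2r// ler_nat.
have hn0 := lt0r_neq0 h0.
(* The Lipschitz bound turns the grid of mesh [h] into a chain of upward steps at most [C * h], at
   heights at most [C * h], whose ends still enclose [[a, b]]. *)
have chain s x : 0 < s <= s0 -> a <= x <= b -> (2 * (C * h) ^+ 2)^-1 <=
    \sum_(j < n.+1) ((x - X s (p j) h) ^+ 2 + Y s (p j) h ^+ 2)^-1.
  move=> /andP[sp ss0] /andP[ax xb].
  have sT : 0 <= s <= T by rewrite ltW//= (le_trans ss0).
  have ll : l <= l <= r by rewrite lexx ltW.
  have lrr : l <= r <= r by rewrite lexx ltW.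
  apply: (@chain_sum_ge _ n (fun j => X s (p j) h) (fun j => Y s (p j) h) (C * h)).
  - apply/andP; split.
      have p0 : p 0%N = l by rewrite /p mul0r addr0.
      have : X s (p 0%N) h <= X s l d + C * d.
        apply: X_lip => //; rewrite ?p0 ?(ltW d0)//.
        by rewrite subrr expr0n /= add0r -sqrrN opprB; apply: sqr_sub_le; rewrite ?(ltW h0).
      have /ler_normlP[_] : `|X s l d - X 0 l d| <= rho by apply: nearl; rewrite ltW//= (le_trans ss0).
      by rewrite Xl0; move: dC rho1 ax; rewrite /l; lra.
    have pn : p n = r by rewrite /p nh addrC subrK.
    have : X s r d <= X s (p n) h + C * d.
      apply: X_lip => //; rewrite ?pn ?(ltW d0)//.
      by rewrite subrr expr0n /= add0r; apply: sqr_sub_le; rewrite ?(ltW h0).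
    have /ler_normlP[+ _] : `|X s r d - X 0 r d| <= rho by apply: nearr; rewrite ltW//= (le_trans ss0).
    by rewrite Xr0; move: dC rho2 xb; rewrite /r; lra.
  - move=> j jn; apply: X_lip => //; [exact/lpr/ltnW|exact: lpr|exact: ltW|].
    have -> : p j.+1 - p j = h by rewrite /p -natr1; ring.
    by rewrite (subrr h) expr0n /= addr0.
  - move=> j jn; rewrite (lt_le_trans h0 (Y_ge _ _ _ (ltW sp) h0))/=.
    by apply: Y_le => //; exact: lpr.
pose f s := \sum_(j < n.+1) Y s (p j) h.
pose df s := \sum_(j < n.+1) Y s (p j) h * Rintegral tau setT
  (fun x => (1 + x ^+ 2) / ((x - X s (p j) h) ^+ 2 + Y s (p j) h ^+ 2)).
have cf : {within [set t : R | 0 <= t], continuous f}.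
  apply: (@within_continuous_sum _ n.+1 (fun j s => Y s (p j) h)) => j.
  by have [[_ cY _ _ _] _ _] := Fl (p j) h h0.
have fdf s : 0 < s < s0 -> is_derive s (1 : R) f (df s).
  move=> /andP[sp _].
  rewrite (_ : f = \sum_(j < n.+1) (fun s => Y s (p j) h)); last first.
    by rewrite fct_sumE.
  apply: is_derive_sum => j; have [[_ _ _ _ dY] _ _] := Fl (p j) h h0.
  exact: dY.
(* Uses [Y >= h] in front and [1 + x ^ 2 >= 1] inside each integral; the chain then bounds the
   summed kernels from below on [I]. *)
have dfm s : 0 < s < s0 -> h * ((2 * (C * h) ^+ 2)^-1 * m) <= df s.
  move=> /andP[sp ss0].
  have Yn0 j : Y s (p j) h != 0 by rewrite lt0r_neq0// (lt_le_trans h0)// Y_ge// ltW.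
  have bc (j : nat) := bounded_measurable_cauchy0 (X s (p j) h) (Yn0 j).
  apply: (le_trans (_ : _ <= h * \sum_(j < n.+1) poisson tau (X s (p j) h) (Y s (p j) h))).
    rewrite ler_wpM2l ?(ltW h0)// /m -(Rint_indic tau mI) -RintZ; last exact: bounded_measurable_indic.
    rewrite -(Rint_sum tau n.+1 bc); apply: le_Rint.
    - by apply: bounded_measurableZ; exact: bounded_measurable_indic.
    - exact: (bounded_measurable_sum n.+1 bc).
    move=> x; rewrite indicE; case: (boolP (x \in I)) => [|_].
      by rewrite inE /I /= in_itv /= mulr1 => axb; apply: (chain s x _ axb); rewrite sp ltW.
    by rewrite mulr0 sumr_ge0// => j _; rewrite invr_ge0 ltW// sqr_distD_gt0.
  rewrite mulr_sumr; apply: ler_sum => j _; apply: ler_pM; [exact: ltW| |by apply: Y_ge; rewrite // ltW|].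
    by apply: Rintegral_ge0 => x _; rewrite invr_ge0 ltW// sqr_distD_gt0.
  apply: le_Rint; [exact: bc|exact: bounded_measurable_vf_Im|].
  move=> x; rewrite -[leLHS]mul1r ler_wpM2r ?invr_ge0 ?(ltW (sqr_distD_gt0 _ _ _))//.
  by rewrite lerDl sqr_ge0.
have : h * ((2 * (C * h) ^+ 2)^-1 * m) * (s0 - 0) <= f s0 - f 0.
  by apply: mean_value_ge cf fdf dfm; rewrite lexx ltW.
have fs0 : f s0 <= 2 * C * (r - l).
  apply: (le_trans (_ : _ <= \sum_(j < n.+1) C * h)).
    by apply: ler_sum => j _; apply: Y_le => //; [rewrite ltW|apply: lpr; rewrite -ltnS].
  rewrite sumr_const card_ord -[leLHS]mulr_natl.
  have n1 : 1 <= n%:R :> R by rewrite ler1n -(ltr0n R).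
  have Ch : 0 <= C * h by rewrite mulr_ge0// ltW.
  have -> : 2 * C * (r - l) = (2 * n%:R) * (C * h) by rewrite -nh; ring.
  by rewrite ler_wpM2r// -natr1; lra.
have f0 : 0 <= f 0.
  by apply: sumr_ge0 => j _; rewrite (le_trans (ltW h0))// Y_ge.
rewrite subr0 => key.
(* This says [m * s0 / (2 C^2 h) <= 2 C (r - l)]; since [h = (r - l) / n], the mass [m] is
   [O(1 / n)]. *)
have {}key := le_trans key (lerB fs0 f0).
have -> : n%:R * (m * s0) = (2 * C ^+ 2 * (r - l)) * (h * ((2 * (C * h) ^+ 2)^-1 * m) * s0).
  by rewrite /h; field; rewrite !lt0r_neq0.
have -> : 4 * C ^+ 3 * (r - l) ^+ 2 = (2 * C ^+ 2 * (r - l)) * (2 * C * (r - l) - 0) by ring.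
by rewrite ler_wpM2l// !mulr_ge0// ?exprn_ge0 ?ltW.
Qed.

End Generator.

(** * A one-dimensional barrier principle *)

Section Barrier.
Context {R : realType}.

Lemma is_derive_gt0_near (f : R -> R) (s d : R) : is_derive s (1 : R) f d -> 0 < d ->
  exists2 e, 0 < e & forall t, s < t < s + e -> f s < f t.
Proof.
move=> [df dfE] d0.
have : (h^-1 *: ((f \o shift s) (h *: (1 : R)) - f s) @[h --> 0^'] --> d)%classic.
  by rewrite -dfE; exact: df.
move=> /cvgr_gt /(_ _ d0); rewrite /prop_near1 => /nbhs_ballP[e /= e0 H].
exists e => // t /andP[st te].
have ts0 : 0 < t - s by rewrite subr_gt0.
have := H (t - s).
rewrite /ball /= sub0r normrN gtr0_norm// ltrBlDl => /(_ te (lt0r_neq0 ts0)).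
rewrite /GRing.scale /= mulr1 subrK pmulr_rgt0 ?invr_gt0// subr_gt0.
by [].
Qed.

(** If [f T < 0], the supremum [s] of the times with [f >= 0] satisfies [0 < s < T] and [f s = 0];
    the positive derivative at [s] makes [f] positive just after [s], a contradiction. *)
Lemma barrier (f df : R -> R) (T : R) : 0 < T ->
  {within [set t : R | 0 <= t], continuous f} -> 0 < f 0 ->
  (forall t, 0 < t < T -> is_derive t (1 : R) f (df t)) ->
  (forall t, 0 < t < T -> f t = 0 -> 0 < df t) -> 0 <= f T.
Proof.
move=> T0 cf f0 fdf df0; rewrite leNgt; apply/negP => fT.
pose S := [set t : R | 0 <= t <= T /\ 0 <= f t].
have S0 : S 0 by split; rewrite ?lexx ?ltW.
have hsS : has_sup S by split; [exists 0 | exists T => t [/andP[]]].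
pose s := sup S.
have s0 : 0 <= s by apply: sup_upper_bound.
have sT : s <= T by apply: sup_le_ub; [exists 0 | move=> t [/andP[]]].
have above t : s < t -> t <= T -> f t < 0.
  move=> st tT; rewrite ltNge; apply/negP => ft; move: (st); rewrite ltNge => /negP; apply.
  by apply: sup_upper_bound => //; split => //; rewrite tT (ltW (le_lt_trans s0 st)).
have fs : f s = 0.
  apply/eqP; rewrite eq_le; apply/andP; split; rewrite leNgt; apply/negP => fs.
    have [d d0 H] := within_continuous_near cf s0 fs.
    have sT' : s < T by rewrite lt_neqAle sT andbT; apply/eqP => sE; move: fs; rewrite sE ltNge ltW.
    pose t := Num.min T (s + d / 2).
    have st : s < t by rewrite lt_min sT' ltrDl divr_gt0.
    have tT : t <= T by rewrite ge_min lexx.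
    have td : t <= s + d / 2 by rewrite ge_min lexx orbT.
    have /ltr_normlP[] : `|f t - f s| < f s.
      by apply: H; rewrite ?gtr0_norm ?subr_gt0 ?(le_trans s0 (ltW st))//; lra.
    by have := above t st tT; lra.
  have fs' : 0 < - f s by rewrite oppr_gt0.
  have [d d0 H] := within_continuous_near cf s0 fs'.
  have [t [/andP[t0 tT] ft] ts] := sup_adherent d0 hsS.
  have ts' : t <= s by apply: sup_upper_bound => //; split; rewrite ?t0.
  have /ltr_normlP[] : `|f t - f s| < - f s.
    by apply: H => //; rewrite ler0_norm ?subr_le0//; move: ts; rewrite -/s; lra.
  by lra.
have sp : 0 < s by rewrite lt_neqAle s0 andbT; apply/eqP => sE; move: f0; rewrite [X in f X]sE fs ltxx.
have sT' : s < T by rewrite lt_neqAle sT andbT; apply/eqP => sE; move: fT; rewrite -sE fs ltxx.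
have sI : 0 < s < T by rewrite sp.
have [e e0 H] := is_derive_gt0_near (fdf s sI) (df0 s sI fs).
pose t := Num.min T (s + e / 2).
have st : s < t by rewrite lt_min sT' ltrDl divr_gt0.
have tT : t <= T by rewrite ge_min lexx.
have td : t <= s + e / 2 by rewrite ge_min lexx orbT.
have := above t st tT; rewrite ltNge => /negP; apply; rewrite -fs ltW// H// st/=.
lra.
Qed.

End Barrier.

(** * The drift on the negative axis and its approximation from above the axis *)

Section DriftBound.
Context {R : realType}.

(** The absolute value keeps [1 / (x + c)] bounded on the whole line without changing it on the
    nonnegative axis. *)
Lemma bounded_measurable_inv_norm (c : R) : 0 < c ->
  bounded_measurable (fun x : R => (`|x| + c)^-1).
Proof.
move=> c0; have xc0 (x : R) : 0 < `|x| + c by rewrite ltr_wpDl.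
split.
  apply: continuous_measurable_fun => x; apply: cvgV; first by rewrite lt0r_neq0.
  by apply: cvgD; [exact: norm_continuous | exact: cvg_cst].
exists c^-1 => x; rewrite gtr0_norm ?invr_gt0// lef_pV2 ?posrE//.
by rewrite lerDr.
Qed.

(* On [x >= 0] the left-hand side is the kernel of the vector field at the real point [-c]. *)
Definition drift_kernel (c x : R) : R := (1 + c ^+ 2) * (`|x| + c)^-1 + (- c).

Lemma bounded_measurable_drift_kernel (c : R) : 0 < c ->
  bounded_measurable (drift_kernel c).
Proof.
move=> c0; apply: bounded_measurableD; last exact: bounded_measurable_cst.
by apply: bounded_measurableZ; exact: bounded_measurable_inv_norm.
Qed.

Lemma drift_kernelE (c x : R) : 0 < c -> 0 <= x ->
  drift_kernel c x = - x + (1 + x ^+ 2) / (x + c).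
Proof.
move=> c0 x0; rewrite /drift_kernel ger0_norm//; field.
by rewrite lt0r_neq0// ltr_wpDl.
Qed.

Lemma drift_kernel_nincr (c c' x : R) : 0 < c -> c <= c' -> 0 <= x ->
  drift_kernel c' x <= drift_kernel c x.
Proof.
move=> c0 cc' x0; have c'0 : 0 < c' := lt_le_trans c0 cc'.
rewrite !drift_kernelE// lerD2l ler_wpM2l ?addr_ge0 ?sqr_ge0//.
by rewrite lef_pV2 ?posrE ?ltr_wpDl// lerD2l.
Qed.

(** Replacing [w / (w^2 + v^2)] by [1 / w], where [w = x - u], costs
    [(1 + x^2) v^2 / (w (w^2 + v^2))]. As [w >= x + d], this is [O(v^2)] uniformly in [x]; then
    [w <= x + c] gives the kernel at [- c]. *)
Lemma vf_Re_ge (c d u v x : R) : 0 < d -> - c <= u <= - d -> v != 0 -> 0 <= x ->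
  drift_kernel c x - v ^+ 2 * ((1 + (d ^+ 2)^-1) / d) <=
  ((1 + x * u) * (x - u) - x * v ^+ 2) / ((x - u) ^+ 2 + v ^+ 2).
Proof.
move=> d0 /andP[cu ud] v0 x0.
have N0 := sqr_distD_gt0 u x v0.
have c0 : 0 < c by lra.
have -> : ((1 + x * u) * (x - u) - x * v ^+ 2) / ((x - u) ^+ 2 + v ^+ 2) =
  - x + (1 + x ^+ 2) * ((x - u) / ((x - u) ^+ 2 + v ^+ 2)).
  by field; rewrite lt0r_neq0.
rewrite drift_kernelE// -addrA lerD2l.
set w := x - u; rewrite -/w in N0 *.
have wd : x + d <= w by rewrite /w; lra.
have wc : w <= x + c by rewrite /w; lra.
have w0 : 0 < w by lra.
have x1 : 0 < 1 + x ^+ 2 by rewrite ltr_pwDl ?sqr_ge0.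
set M := (1 + (d ^+ 2)^-1) / d.
have B1 : (1 + x ^+ 2) / (x + c) <= (1 + x ^+ 2) / w.
  by rewrite ler_wpM2l ?(ltW x1)// lef_pV2 ?posrE//; lra.
have B2 : (1 + x ^+ 2) / w - (1 + x ^+ 2) * (w / (w ^+ 2 + v ^+ 2)) <= v ^+ 2 * M.
  rewrite (_ : _ - _ = (1 + x ^+ 2) * v ^+ 2 / (w * (w ^+ 2 + v ^+ 2))); last first.
    by field; rewrite !lt0r_neq0.
  rewrite ler_pdivrMr ?mulr_gt0// [leLHS]mulrC -[leRHS]mulrA ler_wpM2l ?sqr_ge0//.
  have M0 : 0 <= M by rewrite divr_ge0 ?(ltW d0)// addr_ge0 ?invr_ge0 ?sqr_ge0.
  apply: (@le_trans _ _ (M * (d * w ^+ 2))).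
    rewrite (_ : M * _ = (1 + (d ^+ 2)^-1) * w ^+ 2); last by rewrite /M; field; rewrite lt0r_neq0.
    have xw : x ^+ 2 <= w ^+ 2 by rewrite lerXn2r ?nnegrE; lra.
    have dw : 1 <= (d ^+ 2)^-1 * w ^+ 2.
      by rewrite mulrC ler_pdivlMr ?exprn_gt0// mul1r lerXn2r ?nnegrE; lra.
    by lra.
  rewrite ler_wpM2l//; apply: ler_pM; rewrite ?sqr_ge0 ?(ltW d0)//; first by lra.
  by rewrite lerDl sqr_ge0.
by lra.
Qed.

End DriftBound.

(** * Nonpositive drift on the negative axis and its limit at 0 *)

Section Drift.
Context {R : realType}.
Implicit Types (mu : R -> probability R R) (tau : {finite_measure set R -> \bar R}).

(* A positive drift on some [[-c, 0[] pushes the trajectory starting near [-c/2] past the barrier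
   moving uniformly from [-c] to a point arbitrarily close to [0], which [H_T] cannot reach. *)
Lemma generator_drift_le mu (gamma : R) tau (T c : R) :
  weakly_continuous mu -> associated_pair mu gamma tau ->
  0 < T -> nonneg_carried (mu T) -> nonneg_carried tau -> 0 < c ->
  Rintegral tau setT (drift_kernel c) <= gamma.
Proof.
move=> wc ap T0 supp tau0 c'0; rewrite leNgt; apply/negP => a0.
pose a := Rintegral tau setT (drift_kernel c) - gamma.
have {}a0 : 0 < a by rewrite subr_gt0.
(* Moving from [- c] to [- k] only increases the drift, and a barrier crossing less than [k] in time
   [T] has slope at most [a / 4]. *)
pose k := Num.min c (a * T / 4).
have k0 : 0 < k by rewrite lt_min c'0 divr_gt0// mulr_gt0.
have kc : k <= c by rewrite ge_min lexx.
have kaT : k <= a * T / 4 by rewrite ge_min lexx orbT.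
have ak : a <= Rintegral tau setT (drift_kernel k) - gamma.
  rewrite lerD2r; apply: le_Rint_nonneg => //; [exact: bounded_measurable_drift_kernel..|].
  by move=> x x0; exact: drift_kernel_nincr.
pose l := - k / 2.
have l0 : l < 0 by rewrite /l; lra.
have [q [K [q0 K0 bd]]] := rcauchy_boundary l supp l0.
(* The barrier ends at [- d], strictly to the right of [- q], which bounds the real part of [H_T] on
   the starting segment. *)
pose d := Num.min (q / 2) (k / 2).
have d0 : 0 < d by rewrite lt_min !divr_gt0.
have dq : d <= q / 2 by rewrite ge_min lexx.
have dk : d <= k / 2 by rewrite ge_min lexx orbT.
pose M := (1 + (d ^+ 2)^-1) / d.
have M0 : 0 <= M by rewrite divr_ge0 ?(ltW d0)// addr_ge0 ?invr_ge0 ?sqr_ge0.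
set mass := fine (tau setT); have mass0 : 0 <= mass by rewrite fine_ge0.
pose B := K ^+ 2 * M * mass + 1.
have KM0 : 0 <= K ^+ 2 * M * mass := mulr_ge0 (mulr_ge0 (sqr_ge0 K) M0) mass0.
have B0 : 0 < B by rewrite ltr_wpDl.
(* The starting height. Heights stay below [K * y] up to time [T], so the [O(v^2)] error, integrated
   against [tau], is at most [a / 4]; the [+ 1] in [B] only makes it positive. *)
pose y := Num.min 1 (a / 4 / B).
have y0 : 0 < y by rewrite lt_min ltr01 !divr_gt0.
have y1 : y <= 1 by rewrite ge_min lexx.
have yB : y * B <= a / 4 by rewrite -ler_pdivlMr// ge_min lexx orbT.
have [fl X0 Y0] := associated_pair_flow_line l wc ap y0.
have [||XT YT] := bd l y; [by rewrite lexx | by rewrite y0 |].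
move: fl X0 Y0 XT YT.
set X := fun t => complex.Re (rcauchy (mu t) (Complex l y)).
set Y := fun t => complex.Im (rcauchy (mu t) (Complex l y)).
rewrite -/(X 0) -/(X T) -/(Y 0) -/(Y T) => fl X0 Y0 XT YT.
have [cX _ Ypos dX _] := fl.
pose b t := - k + (k - d) / T * t.
pose f t := X t - b t.
pose df t := - gamma + Rintegral tau setT
        (fun x => ((1 + x * X t) * (x - X t) - x * Y t ^+ 2) / ((x - X t) ^+ 2 + Y t ^+ 2))
        - (k - d) / T.
have kd0 : 0 <= (k - d) / T by rewrite divr_ge0 ?(ltW T0)//; lra.
have kda : (k - d) / T <= a / 4.
  by rewrite ler_pdivrMr// (_ : a / 4 * T = a * T / 4); [lra | ring].
(* It would give [X T >= - d >= - q / 2], against [X T <= - q]. *)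
suff : 0 <= f T.
  by rewrite /f /b divfK ?lt0r_neq0//; lra.
apply: (@barrier _ f df) => //.
- move=> t; apply: cvgB; first exact: cX.
  suff cb : continuous b by exact: (continuous_subspaceT cb).
  move=> r; apply: cvgD; first exact: cvg_cst.
  by apply: cvgM; [exact: cvg_cst | exact: cvg_id].
- by rewrite /f /b mulr0 addr0 X0 /l; lra.
- move=> t /andP[t0 _].
  have hb : is_derive t (1 : R) b ((k - d) / T).
    have h := is_deriveD (is_derive_cst (- k) t 1) (is_deriveZ ((k - d) / T) (is_derive_id t 1)).
    by apply: (is_derive_eq h); rewrite add0r /GRing.scale /= mulr1.
  exact: (is_deriveB (dX t t0) hb).
move=> t /andP[t0 tT] /eqP; rewrite subr_eq0 => /eqP Xb.
have bk : - k <= X t by rewrite Xb /b lerDl mulr_ge0// ltW.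
have bd' : X t <= - d.
  have : (k - d) / T * t <= k - d.
    by rewrite -mulrA ler_piMr ?ler_pdivrMl ?mulr1 ?(ltW tT)//; lra.
  by rewrite Xb /b; lra.
have Yt0 : 0 < Y t by exact/Ypos/ltW.
have Ytn0 := lt0r_neq0 Yt0.
have YtK : Y t <= K * y.
  by apply: le_trans YT; apply: (flow_line_Im_ndecr fl); rewrite !ltW.
have Y2 : Y t ^+ 2 * (M * mass) <= a / 4.
  apply: le_trans yB; apply: (@le_trans _ _ ((K * y) ^+ 2 * (M * mass))).
    apply: ler_wpM2r; first exact: mulr_ge0.
    by rewrite lerXn2r ?nnegrE ?(ltW Yt0)// mulr_ge0 ?(ltW K0) ?(ltW y0).
  have -> : (K * y) ^+ 2 * (M * mass) = y * (y * (K ^+ 2 * M * mass)) by ring.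
  rewrite ler_wpM2l ?(ltW y0)// (@le_trans _ _ (K ^+ 2 * M * mass))//.
    by rewrite ler_piMl.
  by rewrite lerDl.
have : Rintegral tau setT (drift_kernel k) - Y t ^+ 2 * (M * mass) <= Rintegral tau setT
        (fun x => ((1 + x * X t) * (x - X t) - x * Y t ^+ 2) / ((x - X t) ^+ 2 + Y t ^+ 2)).
  have -> : Y t ^+ 2 * (M * mass) = (Y t ^+ 2 * M) * mass by ring.
  rewrite -mulNr -Rint_cst -RintD; [|exact: bounded_measurable_drift_kernel|exact: bounded_measurable_cst].
  apply: le_Rint_nonneg => //.
  - by apply: bounded_measurableD; [exact: bounded_measurable_drift_kernel|exact: bounded_measurable_cst].
  - exact: bounded_measurable_vf_Re.
  by move=> x x0; apply: vf_Re_ge => //; rewrite bk.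
(* At a contact, the relative speed is at least [a - a / 4 - a / 4]: the drift, less the height
   error, less the barrier slope. *)
rewrite /df; set I1 := Rintegral _ _ _; set I2 := Rintegral _ _ _ => I12.
rewrite -/I1 in ak; lra.
Qed.

(** Let [c] decrease to 0. An atom at 0 would make [J c] grow like [1 / c], and monotone convergence
    carries the bound on [J c] over to the integral of [1/x]. *)
Lemma drift_le_integral tau (gamma : R) : nonneg_carried tau ->
  (forall c : R, 0 < c -> Rintegral tau setT (drift_kernel c) <= gamma) ->
  tau [set 0] = 0%E /\
  (\int[tau]_(x in [set x : R | (0 < x)%R]) (x^-1)%R%:E <= gamma%:E)%E.
Proof.
move=> tau0 drift.
set t := fine (tau setT); have t0 : 0 <= t by rewrite fine_ge0.
pose J c := Rintegral tau setT (fun x : R => (`|x| + c)^-1).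
have bJ (c : R) : 0 < c -> bounded_measurable (fun x : R => (`|x| + c)^-1).
  exact: bounded_measurable_inv_norm.
(* Drops the nonnegative term [c ^ 2 * J c] from [(1 + c ^ 2) * J c - c * t <= gamma]. *)
have Jle c : 0 < c -> J c <= gamma + c * t.
  move=> c0; have := drift c c0; rewrite /drift_kernel.
  rewrite RintD; [|by apply: bounded_measurableZ; exact: bJ|exact: bounded_measurable_cst].
  rewrite RintZ; last exact: bJ.
  rewrite Rint_cst -/t -/(J c).
  have J0 : 0 <= J c by apply: Rintegral_ge0 => x _; rewrite invr_ge0 addr_ge0 ?(ltW c0).
  by have := mulr_ge0 (sqr_ge0 c) J0; lra.
split.
  have m0 : measurable [set (0 : R)] by [].
  have tfin : tau [set (0 : R)] \is a fin_num by exact: fin_num_measure.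
  suff tI0 : fine (tau [set (0 : R)]) <= 0.
    rewrite -(fineK tfin); congr EFin; apply/eqP; rewrite eq_le tI0/=.
    by rewrite fine_ge0.
  apply: (@archi_le0 _ _ (`|gamma| + t) 0) => n n0.
  have nR : 0 < n%:R :> R by rewrite ltr0n.
  have c0 : 0 < n%:R^-1 :> R by rewrite invr_gt0.
  apply: (@le_trans _ _ (J n%:R^-1)).
    rewrite -(Rint_indic tau m0) -RintZ; last exact: bounded_measurable_indic.
    apply: le_Rint; [by apply: bounded_measurableZ; exact: bounded_measurable_indic|exact: bJ|].
    move=> x; rewrite indicE; case: (boolP (x \in _)) => [|_].
      by rewrite inE /= => ->; rewrite normr0 add0r invrK mulr1.
    by rewrite mulr0 invr_ge0 addr_ge0 ?(ltW c0).
  apply: (le_trans (Jle _ c0)); apply: lerD; first exact: ler_norm.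
  by rewrite ler_piMl// invf_le1// ler1n.
have mpos := @measurable_pos R.
pose c (n : nat) : R := n.+1%:R^-1.
have c0 n : 0 < c n by rewrite invr_gt0.
pose g (n : nat) (x : R) : \bar R := ((`|x| + c n)^-1)%:E.
have cle (n p : nat) : (n <= p)%N -> c p <= c n.
  by move=> np; rewrite lef_pV2 ?posrE// ler_nat.
have gcvg (x : R) : 0 < x -> limn (g^~ x) = (x^-1)%:E.
  move=> x0; apply/cvg_lim => //; apply: cvg_EFin; first exact: nearW.
  apply: (@cvgV _ _ _ _ (fun n => `|x| + c n)); first by rewrite lt0r_neq0.
  rewrite -[X in _ --> X](gtr0_norm x0) -[X in _ --> X]addr0.
  by apply: cvgD; [exact: cvg_cst | exact: cvg_harmonic].
have mg n : measurable_fun [set x : R | 0 < x] (g n).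
  by apply/measurable_EFinP; apply: (measurable_funS measurableT) => //; exact: (bJ _ (c0 n)).1.
have g0 n x : [set x : R | 0 < x] x -> (0 <= g n x)%E.
  by move=> _; rewrite lee_fin invr_ge0 addr_ge0 ?(ltW (c0 n)).
have gnd x : [set x : R | 0 < x] x -> nondecreasing_seq (g^~ x).
  move=> /= x0 n p np; rewrite lee_fin lef_pV2 ?posrE ?ltr_wpDl//.
  by rewrite lerD2l cle.
have := cvg_monotone_convergence mpos mg g0 gnd (mu := tau).
rewrite (eq_integral (fun x : R => (x^-1)%:E)); last by move=> x; rewrite inE; exact: gcvg.
set L := (\int[tau]_(x in _) _)%E => cvgL.
have gle n : (\int[tau]_(x in [set x : R | (0 < x)%R]) g n x <= (gamma + c n * t)%:E)%E.
  apply: (@le_trans _ _ (\int[tau]_x g n x)%E).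
    apply: ge0_subset_integral => //.
      by apply/measurable_EFinP; exact: (bJ _ (c0 n)).1.
    by move=> x _; rewrite lee_fin invr_ge0 addr_ge0 ?(ltW (c0 n)).
  rewrite -[leLHS]fineK ?lee_fin; first exact: Jle.
  by apply: integrable_fin_num => //; apply: bounded_measurable_integrable; exact: bJ.
have Lle n : (L <= (gamma + c n * t)%:E)%E.
  rewrite -(cvg_lim _ cvgL)//; apply: lime_le; first by apply/cvg_ex; exists L.
  exists n => // p /= np; apply: (le_trans (gle p)).
  by rewrite lee_fin lerD2l ler_wpM2r// cle.
apply/lee_addgt0Pr => e e0; rewrite -EFinD.
pose n := Num.bound (t / e).
apply: (le_trans (Lle n)); rewrite lee_fin lerD2l mulrC ler_pdivrMr// mulrC -ler_pdivrMr//.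
by rewrite ltW// (lt_trans (archi_boundP _)) ?divr_ge0 ?(ltW e0)// ltr_nat.
Qed.

End Drift.

Theorem theorem6p2 (R : realType) (mu : R -> probability R R) (gamma : R)
    (tau : {finite_measure set R -> \bar R}) :
  monotone_semigroup mu ->
  weakly_continuous mu ->
  (forall A : set R, measurable A -> mu 0 A = \d_(0 : R) A) ->
  associated_pair mu gamma tau ->
  [<-> (exists t0 : R, 0 < t0 /\ msupport (mu t0) `<=` [set x : R | 0 <= x]);
       (forall t : R, 0 <= t -> msupport (mu t) `<=` [set x : R | 0 <= x]);
       [/\ msupport tau `<=` [set x : R | 0 <= x],
           tau [set 0 : R] = 0%E,
           (\int[tau]_(x in [set x : R | (0 < x)%R]) (x^-1)%R%:E < +oo)%E &
           (\int[tau]_(x in [set x : R | (0 < x)%R]) (x^-1)%R%:E <= gamma%:E)%E]].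
Proof.
move=> _ wc _ ap.
have H13 : (exists t0 : R, 0 < t0 /\ msupport (mu t0) `<=` [set x : R | 0 <= x]) ->
    [/\ msupport tau `<=` [set x : R | 0 <= x],
        tau [set 0 : R] = 0%E,
        (\int[tau]_(x in [set x : R | (0 < x)%R]) (x^-1)%R%:E < +oo)%E &
        (\int[tau]_(x in [set x : R | (0 < x)%R]) (x^-1)%R%:E <= gamma%:E)%E].
  move=> [T [T0 /msupport_nonneg_null supp]].
  have supp_tau : msupport tau `<=` [set x : R | 0 <= x].
    apply: null_itv_msupport => a b; exact: (generator_null_itv wc ap T0 supp).
  have tau0 := msupport_nonneg_null supp_tau.
  have [zero0 leg] := drift_le_integral tau0 (fun c c0 => generator_drift_le wc ap T0 supp tau0 c0).
  by split => //; rewrite (le_lt_trans leg)// ltry.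
have H32 : [/\ msupport tau `<=` [set x : R | 0 <= x],
        tau [set 0 : R] = 0%E,
        (\int[tau]_(x in [set x : R | (0 < x)%R]) (x^-1)%R%:E < +oo)%E &
        (\int[tau]_(x in [set x : R | (0 < x)%R]) (x^-1)%R%:E <= gamma%:E)%E] ->
    forall t : R, 0 <= t -> msupport (mu t) `<=` [set x : R | 0 <= x].
  move=> [/msupport_nonneg_null tau0 zero0 fin leg] t.
  exact: (generator_msupport wc ap tau0 zero0 fin leg).
have H21 : (forall t : R, 0 <= t -> msupport (mu t) `<=` [set x : R | 0 <= x]) ->
    exists t0 : R, 0 < t0 /\ msupport (mu t0) `<=` [set x : R | 0 <= x].
  by move=> H; exists 1; split; [exact: ltr01 | exact: H].
(* The implications proved form the cycle (1) => (3) => (2) => (1); the cycle in the stated order is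
   obtained by composing them in pairs. *)
by tfae => [/H13/H32|/H21/H13|/H32/H21].
Qed.
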